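(* Let $0<\alpha<1/3$, $d>0$, $\beta\ge1$. Then the system $\dot\theta=F_1(\theta,W)$, $\dot W=F_2(\theta,W)$ on $\Omega_\beta$ has exactly two equilibrium points $(\theta_*,0)$ and $(\theta_{**},0)$, with $0<\theta_*<\theta_\beta$ and $\theta_\beta<\theta_{**}<\pi/2$. Moreover, for every $(\theta_0,W_0)\in\Omega_\beta$ the following are equivalent: (i) the solution with initial data $(\theta_0,W_0)$ is a leapfrogging solution; (ii) $\theta_0\in(\theta_*,\theta_{**})$ and $\mathcal H(\theta_0,W_0)<\min\{\mathcal H(\theta_*,0),\mathcal H(\theta_{**},0)\}$.
   Context: Let $\theta_\beta=\arctan(\beta^{-1/2})\in(0,\pi/2)$ (the unique $\theta\in(0,\pi/2)$ with $\beta^{1/2}\sin\theta=\cos\theta$) and $\Omega_\beta=\{(\theta,W)\in\mathbb{R}^2:\ 0<\theta<\pi/2,\ W\in\mathbb{R},\ (\theta,W)\neq(\theta_\beta,0)\}$. Put $D_\beta(\theta,W)=\frac{d^2}{\beta}(\beta^{1/2}\sin\theta-\cos\theta)^2+W^2$, $$F_1(\theta,W)=\frac{\alpha\beta^{1/2}W}{D_\beta^{3/2}},\qquad F_2(\theta,W)=\frac{\beta^{3/2}\sin\theta-\cos\theta}{d\sin\theta\cos\theta}-\frac{\alpha d^2(\sin\theta+\beta^{1/2}\cos\theta)(\beta^{1/2}\sin\theta-\cos\theta)}{\beta^{1/2}D_\beta^{3/2}},$$ $$\mathcal H(\theta,W)=\frac{1}{2d}\log\!\left(\frac{(1-\sin\theta)^{\beta^{3/2}}(1-\cos\theta)}{(1+\sin\theta)^{\beta^{3/2}}(1+\cos\theta)}\right)-\frac{\alpha\beta^{1/2}}{D_\beta^{1/2}}.$$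 Solutions of this system with data in $\Omega_\beta$ exist globally in time. A solution $(\theta(t),W(t))$, $t\in\mathbb{R}$, is called a leapfrogging solution if it is non-constant and periodic and its orbit $\{(\theta(t),W(t)):t\in\mathbb{R}\}$ is a closed curve in $\Omega_\beta$ revolving around $(\theta_\beta,0)$, i.e. $(\theta_\beta,0)$ lies in the bounded component of the complement of the orbit in $\mathbb{R}^2$. (The system models two coaxial circular vortex filaments of radii $d\beta^{-1/2}\cos\theta$, $d\sin\theta$ and axial separation $W$; leapfrogging means they pass through each other periodically.) *)

(* Defs.v *)
From Stdlib Require Import Reals Lra.
Open Scope R_scope.

Definition theta_b (beta : R) : R := atan (/ sqrt beta).

Definition in_Omega (beta th W : R) : Prop :=
  0 < th < PI / 2 /\ ~ (th = theta_b beta /\ W = 0).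

Definition Dbeta (d beta th W : R) : R :=
  d ^ 2 / beta * (sqrt beta * sin th - cos th) ^ 2 + W ^ 2.

Definition F1 (alpha d beta th W : R) : R :=
  alpha * sqrt beta * W / (Dbeta d beta th W * sqrt (Dbeta d beta th W)).

Definition F2 (alpha d beta th W : R) : R :=
  (beta * sqrt beta * sin th - cos th) / (d * sin th * cos th)
  - alpha * d ^ 2 * (sin th + sqrt beta * cos th) * (sqrt beta * sin th - cos th)
    / (sqrt beta * (Dbeta d beta th W * sqrt (Dbeta d beta th W))).

Definition Ham (alpha d beta th W : R) : R :=
  / (2 * d) * ln ((Rpower (1 - sin th) (beta * sqrt beta) * (1 - cos th))
                  / (Rpower (1 + sin th) (beta * sqrt beta) * (1 + cos th)))
  - alpha * sqrt beta / sqrt (Dbeta d beta th W).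

Definition is_equilibrium (alpha d beta th W : R) : Prop :=
  in_Omega beta th W /\ F1 alpha d beta th W = 0 /\ F2 alpha d beta th W = 0.

Definition is_solution (alpha d beta : R) (th w : R -> R) : Prop :=
  forall t, in_Omega beta (th t) (w t) /\
            derivable_pt_lim th t (F1 alpha d beta (th t) (w t)) /\
            derivable_pt_lim w t (F2 alpha d beta (th t) (w t)).

Definition in_orbit (th w : R -> R) (x y : R) : Prop :=
  exists t, th t = x /\ w t = y.

Definition same_comp_compl (th w : R -> R) (px py qx qy : R) : Prop :=
  exists gx gy : R -> R,
    continuity gx /\ continuity gy /\
    gx 0 = px /\ gy 0 = py /\ gx 1 = qx /\ gy 1 = qy /\
    (forall s, 0 <= s <= 1 -> ~ in_orbit th w (gx s) (gy s)).

Definition in_bounded_comp (th w : R -> R) (px py : R) : Prop :=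
  ~ in_orbit th w px py /\
  exists M, forall qx qy, same_comp_compl th w px py qx qy ->
    Rabs qx <= M /\ Rabs qy <= M.

Definition leapfrogging (beta : R) (th w : R -> R) : Prop :=
  (exists t1 t2, th t1 <> th t2 \/ w t1 <> w t2) /\
  (exists T, 0 < T /\ forall t, th (t + T) = th t /\ w (t + T) = w t) /\
  in_bounded_comp th w (theta_b beta) 0.

(* Main.v *)
(** The system is Hamiltonian: [theta' = d_W H], [W' = - d_theta H], so orbits lie on level curves
    of [H = G(theta) - A / rho], where [A = alpha sqrt beta], [rho = sqrt D_beta] and [G < 0] is
    concave.  A level bounds [sin theta], [cos theta] and [rho] away from 0, so the field may be
    replaced by a globally Lipschitz one: this gives uniqueness and global existence.  On the axis
    [W = 0], [F_2] is strictly increasing on either side of [theta_beta], hence there is one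
    equilibrium on each side, and it is the strict maximum of [H(., 0)] on that side.

    If an orbit encloses [(theta_beta, 0)], the two horizontal rays from this point hit it, so its
    energy is a value of [H(., 0)] on both sides, below both maxima by uniqueness.  Conversely,
    for such an energy the equation reduces along the orbit to functions of [theta] alone; if [W]
    had constant sign from some time on, [theta] would converge to a rest point, and there is none
    at this energy.  Hence [W] vanishes again and again.  Composing the time reversals
    [(theta, W) -> (theta, - W)] at two such times is a translation of time, so the solution is
    periodic, and its orbit is the whole level curve, which separates [(theta_beta, 0)] from
    infinity. *)
Require Import Defs.
From Stdlib Require Import Reals Lra Psatz Classical_Prop.
From Coquelicot Require Import Coquelicot.
Open Scope R_scope.

(** * Real functions *)

Lemma derive_nonneg_le (f df : R -> R) (a b : R) :
  a <= b -> (forall t, a <= t <= b -> is_derive f t (df t)) ->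
  (forall t, a <= t <= b -> 0 <= df t) -> f a <= f b.
Proof.
intros Hab Hd Hp.
destruct (MVT_gen f a b df) as [c [Hc He]].
- intros x Hx; rewrite Rmin_left, Rmax_right in Hx by lra; apply Hd; lra.
- intros x Hx; rewrite Rmin_left, Rmax_right in Hx by lra.
  apply continuity_pt_filterlim, (ex_derive_continuous f); exists (df x); apply Hd; lra.
- rewrite Rmin_left, Rmax_right in Hc by lra.
  assert (0 <= df c * (b - a)) by (apply Rmult_le_pos; [apply Hp; lra | lra]). lra.
Qed.

Lemma derive_pos_lt (f df : R -> R) (u v : R) :
  u < v -> (forall t, u <= t <= v -> is_derive f t (df t)) ->
  (forall t, u < t < v -> 0 < df t) -> f u < f v.
Proof.
intros Huv Hf Hp.
destruct (MVT_cor2 f df u v Huv) as [t [e Ht]].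
- intros t Ht; apply is_derive_Reals, Hf, Ht.
- assert (0 < df t * (v - u)) by (apply Rmult_lt_0_compat; [apply Hp, Ht|lra]); lra.
Qed.

Lemma derive_zero_eq (f : R -> R) (a b : R) :
  (forall t, Rmin a b <= t <= Rmax a b -> is_derive f t 0) -> f a = f b.
Proof.
intros Hd.
assert (Hab : forall a b, a <= b -> (forall t, a <= t <= b -> is_derive f t 0) -> f a = f b).
{ clear; intros a b Hab Hd. apply Rle_antisym.
  - apply derive_nonneg_le with (df := fun _ => 0); auto; intros; lra.
  - apply Ropp_le_cancel.
    apply (derive_nonneg_le (fun t => - f t) (fun _ => 0)); auto; try (intros; lra).
    intros t Ht; evar_last; [refine (is_derive_opp _ _ _ _); apply Hd; exact Ht | apply Ropp_0]. }
destruct (Rle_dec a b) as [h|h].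
- apply Hab; auto; intros t Ht; apply Hd; rewrite Rmin_left, Rmax_right; lra.
- symmetry; apply Hab; try lra; intros t Ht; apply Hd; rewrite Rmin_right, Rmax_left; lra.
Qed.

Lemma continuity_Rmin (f g : R -> R) :
  continuity f -> continuity g -> continuity (fun t => Rmin (f t) (g t)).
Proof.
intros Hf Hg.
intros t; apply (continuity_pt_ext (fun t => (f t + g t - Rabs (f t - g t)) * / 2)).
- clear t; intros t; unfold Rmin, Rabs; destruct Rle_dec; destruct Rcase_abs; lra.
- apply continuity_pt_mult; [|apply continuity_pt_const; intros ? ?; reflexivity].
  apply continuity_pt_minus; [apply continuity_pt_plus; auto|].
  apply (continuity_pt_comp (fun t => f t - g t) Rabs); [apply continuity_pt_minus; auto|].
  apply Rcontinuity_abs.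
Qed.

Lemma continuity_pos_nbhd (m : R -> R) (t : R) :
  continuity m -> 0 < m t -> exists e, 0 < e /\ forall s, Rabs (s - t) < e -> 0 < m s.
Proof.
intros Hm Ht; destruct (Hm t (m t) Ht) as [e [He H]].
exists e; split; [exact He|intros s Hs].
destruct (Req_dec s t) as [->|hn]; [assumption|].
specialize (H s); simpl in H; unfold Rdist, D_x, no_cond in H.
assert (h : Rabs (m s - m t) < m t) by (apply H; repeat split; auto).
apply Rabs_def2 in h; lra.
Qed.

(** Continuous induction. At the supremum [tau] of the times up to which [m] is positive, continuity
    gives [m >= 0] on [[0, tau]], the hypothesis improves this to [0 < m tau], and continuity
    carries positivity past [tau]. Negative times follow by reversing time. This is the form in
    which a priori bounds are used: a weak bound so far implies the strict bound now. *)
Lemma positivity_propagates (m : R -> R) :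
  continuity m -> 0 < m 0 ->
  (forall t, (forall r, Rmin 0 t <= r <= Rmax 0 t -> 0 <= m r) -> 0 < m t) ->
  forall t, 0 < m t.
Proof.
assert (pos : forall m : R -> R, continuity m -> 0 < m 0 ->
  (forall t, (forall r, Rmin 0 t <= r <= Rmax 0 t -> 0 <= m r) -> 0 < m t) ->
  forall t, 0 <= t -> 0 < m t).
{ clear m; intros m Hc H0 Hstep t Ht.
  destruct (Rlt_dec 0 (m t)) as [h|h]; [assumption|exfalso].
  pose (S := fun s => 0 <= s <= t /\ forall r, 0 <= r <= s -> 0 < m r).
  assert (S0 : S 0) by (split; [lra|intros r Hr; replace r with 0 by lra; assumption]).
  destruct (completeness S) as [tau [Hub Hlub]].
  - exists t; intros s [Hs _]; lra.
  - exists 0; exact S0.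
  - assert (Htau : 0 <= tau <= t).
    { split; [apply Hub, S0|apply Hlub; intros s [Hs _]; lra]. }
    assert (Hbelow : forall r, 0 <= r < tau -> 0 < m r).
    { intros r Hr; destruct (Rlt_dec 0 (m r)) as [g|g]; [assumption|exfalso].
      assert (tau <= r); [|lra].
      apply Hlub; intros s [Hs1 Hs2]; destruct (Rle_dec s r) as [k|k]; [assumption|].
      exfalso; apply g, Hs2; lra. }
    assert (Hmt : 0 < m tau).
    { apply Hstep; intros r; rewrite Rmin_left, Rmax_right by lra; intros Hr.
      destruct (Req_dec r tau) as [->|hn]; [|left; apply Hbelow; lra].
      destruct (Rle_dec 0 (m tau)) as [g|g]; [assumption|exfalso].
      destruct (continuity_pos_nbhd (fun s => - m s) tau) as [e [He Hn]].
      - apply continuity_opp; assumption.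
      - lra.
      - assert (0 < tau).
        { destruct (Req_dec tau 0) as [k|k]; [rewrite k in g; lra|lra]. }
        pose (r := Rmax 0 (tau - e / 2)).
        assert (hr : 0 <= r < tau /\ Rabs (r - tau) < e).
        { unfold r, Rmax, Rabs; destruct Rle_dec; destruct Rcase_abs; lra. }
        generalize (Hbelow r (proj1 hr)) (Hn r (proj2 hr)); lra. }
    destruct (continuity_pos_nbhd m tau Hc Hmt) as [e [He Hn]].
    destruct (Req_dec tau t) as [->|hne]; [contradiction|].
    pose (s := Rmin t (tau + e / 2)).
    assert (hs : tau < s /\ s <= t /\ s <= tau + e / 2).
    { unfold s, Rmin; destruct Rle_dec; lra. }
    assert (s <= tau); [|lra].
    apply Hub; split; [lra|intros r Hr].
    destruct (Rlt_dec r tau) as [k|k]; [apply Hbelow; lra|].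
    apply Hn, Rabs_def1; lra. }
intros Hc H0 Hstep t; destruct (Rle_dec 0 t) as [h|h]; [apply pos; assumption|].
rewrite <- (Ropp_involutive t).
apply (pos (fun t => m (- t))); try lra.
- intros s; apply (continuity_pt_comp (fun s => - s) m); [|apply Hc].
  apply continuity_pt_opp, derivable_continuous_pt, derivable_pt_id.
- rewrite Ropp_0; assumption.
- intros s Hs; apply Hstep; intros r Hr.
  rewrite <- (Ropp_involutive r); apply Hs.
  revert Hr; unfold Rmin, Rmax; repeat destruct Rle_dec; lra.
Qed.

(** * Limits at infinity and sign changes *)

Definition tends_to (x : R -> R) (l : R) :=
  forall e, 0 < e -> exists T, forall t, T <= t -> Rabs (x t - l) < e.

Lemma monotone_tends_to (x : R -> R) t0 M :
  (forall s t, t0 <= s -> s <= t -> x s <= x t) -> (forall t, t0 <= t -> x t <= M) ->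
  exists l, tends_to x l.
Proof.
intros Hm HM.
destruct (completeness (fun v => exists t, t0 <= t /\ x t = v)) as [l [Hub Hlub]].
- exists M; intros v [t [Ht <-]]; auto.
- exists (x t0), t0; split; [lra|reflexivity].
- exists l; intros e He.
  destruct (classic (exists t, t0 <= t /\ l - e < x t)) as [[t [Ht1 Ht2]]|h].
  + exists t; intros s Hs; apply Rabs_def1.
    * assert (x s <= l) by (apply Hub; exists s; split; [lra|reflexivity]); lra.
    * generalize (Hm t s Ht1 Hs); lra.
  + exfalso; assert (l <= l - e); [|lra].
    apply Hlub; intros v [t [Ht <-]]; apply Rnot_lt_le; intros k; apply h; exists t; auto.
Qed.

Lemma tends_to_comp (x : R -> R) l (f : R -> R) :
  tends_to x l -> continuity_pt f l -> tends_to (fun t => f (x t)) (f l).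
Proof.
intros Hx Hf e He; destruct (Hf e He) as [a [Ha H]].
destruct (Hx a Ha) as [T HT]; exists T; intros t Ht.
destruct (Req_dec (x t) l) as [->|hn]; [rewrite Rminus_diag, Rabs_R0; assumption|].
apply H; split; [split; [exact I|auto]|apply HT, Ht].
Qed.

Lemma tends_to_opp (x : R -> R) l : tends_to x l -> tends_to (fun t => - x t) (- l).
Proof.
intros Hx; apply (tends_to_comp x l Ropp); [assumption|].
apply continuity_pt_opp, derivable_continuous_pt, derivable_pt_id.
Qed.

Lemma tends_to_ge0 (x : R -> R) l t0 :
  tends_to x l -> (forall t, t0 <= t -> 0 <= x t) -> 0 <= l.
Proof.
intros Hx Hp; apply Rnot_lt_le; intros h.
destruct (Hx (- l)) as [T HT]; [lra|].
specialize (HT (Rmax T t0) (Rmax_l _ _)); specialize (Hp (Rmax T t0) (Rmax_r _ _)).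
apply Rabs_def2 in HT; lra.
Qed.

(** A positive limit of the derivative would eventually force growth with slope at least [l / 2],
    which no bounded function allows; a negative limit is handled by passing to [- u]. *)
Lemma bounded_derive_limit (u du : R -> R) l t0 B :
  (forall t, t0 <= t -> is_derive u t (du t)) -> (forall t, t0 <= t -> Rabs (u t) <= B) ->
  tends_to du l -> l = 0.
Proof.
assert (main : forall (u du : R -> R) l, (forall t, t0 <= t -> is_derive u t (du t)) ->
  (forall t, t0 <= t -> Rabs (u t) <= B) -> tends_to du l -> l <= 0).
{ clear u du l; intros u du l Hd HB Hl; apply Rnot_lt_le; intros h.
  destruct (Hl (l / 2)) as [T HT]; [lra|].
  pose (a := Rmax T t0).
  assert (Ha : T <= a /\ t0 <= a) by (split; [apply Rmax_l|apply Rmax_r]).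
  assert (HB0 : 0 <= B) by (eapply Rle_trans; [apply Rabs_pos|apply (HB a); lra]).
  (* Over [[a, c]] the slope [l / 2] produces a gain of [4 * B + 1], more than the variation [2 * B]
     that the bound permits. *)
  pose (c := a + (4 * B + 1) / l * 2).
  assert (Hc : a <= c).
  { assert (0 < (4 * B + 1) / l) by (apply Rdiv_lt_0_compat; lra); unfold c; lra. }
  assert (g : u a - l / 2 * a <= u c - l / 2 * c).
  { apply (derive_nonneg_le (fun t => u t - l / 2 * t) (fun t => du t - l / 2)); [assumption| |].
    - intros t Ht; apply @is_derive_minus; [apply Hd; lra|].
      auto_derive; [trivial|ring].
    - intros t Ht; generalize (HT t ltac:(lra)); intros k; apply Rabs_def2 in k; lra. }
  assert (e : l / 2 * c = l / 2 * a + (4 * B + 1)) by (unfold c; field; lra).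
  generalize (HB a ltac:(lra)) (HB c ltac:(lra)) (Rle_abs (u c)) (Rle_abs (- u a)).
  rewrite Rabs_Ropp; lra. }
intros Hd HB Hl; apply Rle_antisym.
- apply (main u du); assumption.
- assert (- l <= 0); [|lra].
  apply (main (fun t => - u t) (fun t => - du t)).
  + intros t Ht; refine (is_derive_opp _ _ _ _); auto.
  + intros t Ht; rewrite Rabs_Ropp; auto.
  + apply tends_to_opp, Hl.
Qed.

Lemma upcrossing_nbhd (y : R -> R) (dy t : R) :
  is_derive y t dy -> 0 < dy -> y t = 0 ->
  exists e, 0 < e /\ (forall s, t - e < s < t -> y s < 0) /\ (forall s, t < s < t + e -> 0 < y s).
Proof.
intros Hd Hp H0; apply is_derive_Reals in Hd.
destruct (Hd dy Hp) as [e He]; exists e; split; [apply cond_pos|].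
assert (key : forall h, h <> 0 -> Rabs h < e -> 0 < y (t + h) * / h).
{ intros h hn hh; specialize (He h hn hh); apply Rabs_def2 in He.
  rewrite H0, Rminus_0_r in He; unfold Rdiv in He; lra. }
split; intros s Hs; generalize (key (s - t) ltac:(lra) ltac:(apply Rabs_def1; lra));
  replace (t + (s - t)) with s by ring; intros k.
- assert (/ (s - t) < 0) by (apply Rinv_lt_0_compat; lra); nra.
- assert (0 < / (s - t)) by (apply Rinv_0_lt_compat; lra); nra.
Qed.

(** Just after [a] the function is positive. A first later zero would be reached through nonnegative
    values, while a positive slope there makes the function negative just before it. *)
Lemma no_two_upcrossings (y dy : R -> R) a c : a < c ->
  (forall t, is_derive y t (dy t)) -> y a = 0 -> y c = 0 ->
  (forall t, y t = 0 -> 0 < dy t) -> False.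
Proof.
intros Hac Hd Ha Hc Hup.
assert (cy : continuity y)
  by (intros t; apply derivable_continuous_pt; eexists; apply is_derive_Reals, Hd).
destruct (upcrossing_nbhd y (dy a) a (Hd a) (Hup a Ha) Ha) as [e [He [_ Hpos]]].
pose (a' := a + Rmin (e / 2) ((c - a) / 2)).
assert (Ha' : a < a' < a + e /\ a' < c) by (unfold a', Rmin; destruct Rle_dec; lra).
(* Freezing [y] outside [a', c] makes it positive everywhere. *)
pose (m := fun t => y (Rmax a' (Rmin c (a' + t)))).
assert (mpos : forall t, 0 < m t).
{ apply positivity_propagates.
  - intros t; apply (continuity_pt_comp (fun t => Rmax a' (Rmin c (a' + t))) y); [|apply cy].
    apply (continuity_pt_ext (fun t => - Rmin (- a') (- Rmin c (a' + t)))).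
    + intros s; rewrite <- Ropp_Rmax, !Ropp_involutive; reflexivity.
    + apply continuity_pt_opp, continuity_Rmin.
      * intros s; apply continuity_pt_const; intros ? ?; reflexivity.
      * apply continuity_opp, continuity_Rmin; intros s; reg.
  - unfold m; rewrite Rplus_0_r, Rmin_right, Rmax_left by lra; apply Hpos; lra.
  - intros t Ht; destruct (Rle_dec t 0) as [h|h].
    + unfold m; rewrite Rmax_left by (eapply Rle_trans; [apply Rmin_r|lra]); apply Hpos; lra.
    + rewrite Rmin_left, Rmax_right in Ht by lra.
      set (r := Rmax a' (Rmin c (a' + t))); change (0 < y r).
      assert (Hr : a' < r <= c /\ r <= a' + t)
        by (unfold r, Rmax, Rmin; repeat destruct Rle_dec; lra).
      assert (nn : forall s, a' <= s <= r -> 0 <= y s).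
      { intros s Hs; generalize (Ht (s - a') ltac:(lra)); unfold m.
        replace (a' + (s - a')) with s by ring.
        rewrite Rmin_right, Rmax_right by lra; auto. }
      destruct (Rle_lt_or_eq_dec _ _ (nn r ltac:(lra))) as [k|k]; [assumption|exfalso].
      destruct (upcrossing_nbhd y (dy r) r (Hd r) (Hup r (eq_sym k)) (eq_sym k))
        as [f [Hf [Hneg _]]].
      pose (s := Rmax a' (r - f / 2)).
      assert (Hs : a' <= s /\ r - f < s < r) by (unfold s, Rmax; destruct Rle_dec; lra).
      generalize (Hneg s (proj2 Hs)) (nn s ltac:(lra)); lra. }
generalize (mpos (c - a')); unfold m.
replace (a' + (c - a')) with c by ring; rewrite Rmin_left, Rmax_right by lra; lra.
Qed.

(** * Globally Lipschitz planar systems *)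

Lemma is_derive_sqr_diff (f g : R -> R) (t df dg : R) :
  is_derive f t df -> is_derive g t dg ->
  is_derive (fun s => (f s - g s) ^ 2) t (2 * (f t - g t) * (df - dg)).
Proof.
intros Hf Hg; auto_derive.
- repeat split; eexists; eassumption.
- replace (Derive (fun x => f x) t) with df by (symmetry; apply is_derive_unique; exact Hf).
  replace (Derive (fun x => g x) t) with dg by (symmetry; apply is_derive_unique; exact Hg).
  ring.
Qed.

(** The barrier [v = k (exp (K t) - exp (- K t))] vanishes at 0 and has the bound on [du] as its
    derivative. Hence [v - u] and [v + u] are both nondecreasing, and [v] controls [u] on either
    side of 0. In terms of the weight [exp (K t) + exp (- K t)], integration from 0 gains a factor
    [1 / K]. *)
Lemma derive_exp_bound (u du : R -> R) (K k : R) :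
  0 < K -> u 0 = 0 -> (forall t, is_derive u t (du t)) ->
  (forall t, Rabs (du t) <= K * k * (exp (K * t) + exp (- (K * t)))) ->
  forall t, Rabs (u t) <= k * (exp (K * t) + exp (- (K * t))).
Proof.
intros HK H0 Hd Hb t.
set (v := fun t => k * (exp (K * t) - exp (- (K * t)))).
assert (Hv : forall t, is_derive v t (K * k * (exp (K * t) + exp (- (K * t))))).
{ intros s; unfold v; auto_derive; [trivial | ring]. }
assert (Hv0 : v 0 = 0) by (unfold v; rewrite Rmult_0_r, Ropp_0; ring).
assert (Hm : forall a b, a <= b -> v a - u a <= v b - u b).
{ intros a b Hab.
  apply (derive_nonneg_le (fun s => v s - u s)
    (fun s => K * k * (exp (K * s) + exp (- (K * s))) - du s)); auto.
  - intros s _; refine (is_derive_minus _ _ _ _ _ _ _); auto.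
  - intros s _; generalize (Hb s) (Rle_abs (du s)); lra. }
assert (Hp : forall a b, a <= b -> v a + u a <= v b + u b).
{ intros a b Hab.
  apply (derive_nonneg_le (fun s => v s + u s)
    (fun s => K * k * (exp (K * s) + exp (- (K * s))) + du s)); auto.
  - intros s _; refine (is_derive_plus _ _ _ _ _ _ _); auto.
  - intros s _; generalize (Hb s) (Rle_abs (- du s)); rewrite Rabs_Ropp; lra. }
assert (Hk : 0 <= k).
{ generalize (Rle_trans _ _ _ (Rabs_pos _) (Hb 0)); rewrite Rmult_0_r, Ropp_0, exp_0; nra. }
generalize (exp_pos (K * t)) (exp_pos (- (K * t))); intros e1 e2.
apply Rabs_le.
destruct (Rle_dec 0 t) as [h|h].
- generalize (Hm 0 t h) (Hp 0 t h); unfold v in *; nra.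
- assert (h' : t <= 0) by lra.
  generalize (Hm t 0 h') (Hp t 0 h'); unfold v in *; nra.
Qed.

(** The tail of the geometric series gives the error [2 * B * (/ 2) ^ n]. The limit comes in a sigma
    type so that pointwise limits can be collected into a function of time without a choice
    principle. *)
Lemma geometric_cauchy (u : nat -> R) (B : R) :
  (forall n, Rabs (u (S n) - u n) <= B * (/ 2) ^ n) ->
  {l : R | forall n, Rabs (l - u n) <= 2 * B * (/ 2) ^ n}.
Proof.
intros Hu.
assert (HB : 0 <= B).
{ generalize (Rle_trans _ _ _ (Rabs_pos _) (Hu 0%nat)); simpl; lra. }
assert (Hk : forall n k, Rabs (u (n + k)%nat - u n) <= 2 * B * (/ 2) ^ n * (1 - (/ 2) ^ k)).
{ intros n; induction k as [|k IH].
  - rewrite Nat.add_0_r, Rminus_diag, Rabs_R0; simpl; lra.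
  - replace (u (n + S k)%nat - u n) with ((u (S (n + k)) - u (n + k)%nat) + (u (n + k)%nat - u n))
      by (rewrite Nat.add_succ_r; ring).
    eapply Rle_trans; [apply Rabs_triang|].
    generalize (Hu (n + k)%nat); rewrite pow_add; simpl; lra. }
assert (Hk' : forall n k, Rabs (u (n + k)%nat - u n) <= 2 * B * (/ 2) ^ n).
{ intros n k; eapply Rle_trans; [apply Hk|].
  assert (0 <= 2 * B * (/ 2) ^ n * (/ 2) ^ k)
    by (repeat apply Rmult_le_pos; try lra; apply pow_le; lra). lra. }
destruct (Rcomplete.R_complete u) as [l Hl].
- intros e He.
  destruct (pow_lt_1_zero (/ 2)) with (y := e / (4 * B + 1)) as [N HN].
  + rewrite Rabs_pos_eq; lra.
  + apply Rdiv_lt_0_compat; lra.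
  + exists N; intros n m Hn Hm.
    assert (H1 : forall n, (n >= N)%nat -> Rabs (u n - u N) <= 2 * B * (/ 2) ^ N).
    { intros j Hj; replace j with (N + (j - N))%nat by lia; apply Hk'. }
    unfold Rdist; replace (u n - u m) with ((u n - u N) - (u m - u N)) by ring.
    eapply Rle_lt_trans; [apply Rabs_triang|]; rewrite Rabs_Ropp.
    generalize (H1 n Hn) (H1 m Hm) (HN N (le_n N)).
    rewrite (Rabs_pos_eq ((/ 2) ^ N)) by (apply pow_le; lra); intros h1 h2 h3.
    assert (0 < (/ 2) ^ N) by (apply pow_lt; lra).
    apply Rle_lt_trans with ((4 * B) * (/ 2) ^ N); [lra|].
    apply Rlt_le_trans with ((4 * B + 1) * (/2) ^ N); [lra|].
    apply Rle_trans with ((4 * B + 1) * (e / (4 * B + 1))); [nra|].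
    right; field; lra.
- exists l; intros n.
  apply Rle_plus_epsilon; intros e He.
  destruct (Hl e He) as [N HN].
  generalize (HN (n + N)%nat ltac:(lia)) (Hk' n N); unfold Rdist; intros h1 h2.
  replace (l - u n) with (- (u (n + N)%nat - l) + (u (n + N)%nat - u n)) by ring.
  eapply Rle_trans; [apply Rabs_triang|]; rewrite Rabs_Ropp; lra.
Qed.

Section PlanarODE.
Context (f : bool -> R -> R -> R) (L : R).
Context (HL : 1 <= L)
  (f_lip : forall i x y u v, Rabs (f i x y - f i u v) <= L * (Rabs (x - u) + Rabs (y - v))).

Lemma lipschitz_continuous_comp i (x y : R -> R) t :
  continuous x t -> continuous y t -> continuous (fun s => f i (x s) (y s)) t.
Proof.
intros Hx Hy.
apply continuity_pt_filterlim; apply continuity_pt_filterlim in Hx, Hy.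
intros e He.
assert (Hq : 0 < e / (2 * L)) by (apply Rdiv_lt_0_compat; lra).
destruct (Hx (e / (2 * L)) Hq) as [d1 [Hd1 H1]].
destruct (Hy (e / (2 * L)) Hq) as [d2 [Hd2 H2]].
exists (Rmin d1 d2); split; [apply Rmin_glb_lt; assumption|].
intros s [Hs1 Hs2].
generalize (H1 s (conj Hs1 (Rlt_le_trans _ _ _ Hs2 (Rmin_l _ _))))
           (H2 s (conj Hs1 (Rlt_le_trans _ _ _ Hs2 (Rmin_r _ _)))).
simpl; unfold Rdist; intros h1 h2.
eapply Rle_lt_trans; [apply f_lip|].
apply Rlt_le_trans with (L * (e / (2 * L) + e / (2 * L))).
- apply Rmult_lt_compat_l; lra.
- right; field; lra.
Qed.

(** The Boolean selects the coordinate, [true] for the first and [false] for the second, so that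
    each statement about the iterates covers both. *)
Fixpoint picard_iter (z0 : bool -> R) (n : nat) (i : bool) (t : R) : R :=
  match n with
  | O => z0 i
  | S m => z0 i + RInt (fun s => f i (picard_iter z0 m true s) (picard_iter z0 m false s)) 0 t
  end.

Lemma derive_integral (c : R) (g : R -> R) t :
  (forall s, continuous g s) -> is_derive (fun t => c + RInt g 0 t) t (g t).
Proof.
intros Hg.
evar_last.
- refine (is_derive_plus _ _ _ _ _ _ _); [apply is_derive_const|].
  apply (is_derive_RInt g _ 0 t); auto.
  apply filter_forall; intros s; refine (RInt_correct _ _ _ _); apply ex_RInt_continuous; auto.
- apply plus_zero_l.
Qed.

Lemma picard_iter_continuous z0 n i t : continuous (picard_iter z0 n i) t.
Proof.
revert i t; induction n as [|n IH]; intros i t.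
- apply continuous_const.
- apply (ex_derive_continuous (picard_iter z0 (S n) i)); eexists.
  refine (derive_integral _ _ _ _); intros s; apply lipschitz_continuous_comp; apply IH.
Qed.

Lemma picard_iter_derive z0 n i t :
  is_derive (picard_iter z0 (S n) i) t (f i (picard_iter z0 n true t) (picard_iter z0 n false t)).
Proof.
refine (derive_integral _ _ _ _); intros s.
apply lipschitz_continuous_comp; apply picard_iter_continuous.
Qed.

Lemma picard_iter_0 z0 n i : picard_iter z0 n i 0 = z0 i.
Proof.
destruct n; simpl; [reflexivity|].
rewrite RInt_point; apply Rplus_0_r.
Qed.

(* The weight [exp (K t) + exp (- K t)] makes the Picard operator contract by 1/2 on the whole
   real line at once, so no local solutions have to be glued. *)
Let K := 4 * L.
Let w t := exp (K * t) + exp (- (K * t)).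

Lemma weight_ge1 t : 1 <= w t.
Proof.
unfold w; destruct (Rle_dec 0 (K * t)).
- generalize (exp_ineq1_le (K * t)) (exp_pos (- (K * t))); lra.
- generalize (exp_ineq1_le (- (K * t))) (exp_pos (K * t)); lra.
Qed.

Let C z0 := Rabs (f true (z0 true) (z0 false)) + Rabs (f false (z0 true) (z0 false)).

(** The Lipschitz bound costs [2 * L], because the increments of both coordinates enter, and the
    weighted integration gains [1 / K = 1 / (4 * L)]; the product is [1 / 2]. The first increment is
    governed by the speed at the initial point, which [C z0] bounds. *)
Lemma picard_iter_step z0 n i t :
  Rabs (picard_iter z0 (S n) i t - picard_iter z0 n i t) <= C z0 * w t * (/ 2) ^ n.
Proof.
assert (HC : 0 <= C z0) by (unfold C; generalize (Rabs_pos (f true (z0 true) (z0 false)))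
  (Rabs_pos (f false (z0 true) (z0 false))); lra).
assert (HK : 0 < K) by (unfold K; lra).
replace (C z0 * w t * (/ 2) ^ n) with (C z0 * (/ 2) ^ n * w t) by ring.
revert i t; induction n as [|n IH]; intros i t.
- apply (derive_exp_bound (fun t => picard_iter z0 1 i t - picard_iter z0 0 i t)
    (fun t => f i (z0 true) (z0 false))); auto.
  + rewrite !picard_iter_0; ring.
  + intros s; evar_last.
    * refine (is_derive_minus _ _ _ _ _ _ _); [apply picard_iter_derive | apply @is_derive_const].
    * apply Rminus_0_r.
  + intros s; generalize (weight_ge1 s); fold (w s); intros Hw.
    apply Rle_trans with (C z0).
    * unfold C; generalize (Rabs_pos (f true (z0 true) (z0 false)))
        (Rabs_pos (f false (z0 true) (z0 false))); destruct i; lra.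
    * assert (1 <= K * w s) by (unfold K in *; nra). simpl; nra.
- apply (derive_exp_bound (fun t => picard_iter z0 (S (S n)) i t - picard_iter z0 (S n) i t)
    (fun t => f i (picard_iter z0 (S n) true t) (picard_iter z0 (S n) false t)
              - f i (picard_iter z0 n true t) (picard_iter z0 n false t))); auto.
  + rewrite !picard_iter_0; ring.
  + intros s; refine (is_derive_minus _ _ _ _ _ _ _); apply picard_iter_derive.
  + intros s; eapply Rle_trans; [apply f_lip|].
    generalize (IH true s) (IH false s); fold (w s); unfold K; simpl pow; intros h1 h2.
    apply Rle_trans with (L * (2 * (C z0 * (/ 2) ^ n * w s))); [|right; field].
    apply Rmult_le_compat_l; lra.
Qed.

Lemma picard (z0 : bool -> R) :
  exists z : bool -> R -> R, forall i,
    z i 0 = z0 i /\ forall t, is_derive (z i) t (f i (z true t) (z false t)).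
Proof.
pose (z := fun i t => proj1_sig (geometric_cauchy (fun n => picard_iter z0 n i t) (C z0 * w t)
  (fun n => picard_iter_step z0 n i t))).
assert (Hz : forall i t n, Rabs (z i t - picard_iter z0 n i t) <= 2 * (C z0 * w t) * (/ 2) ^ n).
{ intros i t n; unfold z; destruct geometric_cauchy as [l Hl]; apply Hl. }
assert (HC : 0 <= C z0) by (unfold C; generalize (Rabs_pos (f true (z0 true) (z0 false)))
  (Rabs_pos (f false (z0 true) (z0 false))); lra).
assert (small : forall B e, 0 <= B -> 0 < e -> exists n, B * (/ 2) ^ n < e).
{ intros B e HB He.
  destruct (pow_lt_1_zero (/ 2)) with (y := e / (B + 1)) as [N HN].
  - rewrite Rabs_pos_eq; lra.
  - apply Rdiv_lt_0_compat; lra.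
  - exists N; generalize (HN N (le_n N)).
    rewrite (Rabs_pos_eq ((/ 2) ^ N)) by (apply pow_le; lra); intros h.
    assert (0 < (/ 2) ^ N) by (apply pow_lt; lra).
    apply Rlt_le_trans with ((B + 1) * (e / (B + 1))); [nra|right; field; lra]. }
(* The convergence is not uniform on the whole line, but near [t] the weight stays below [w t + 1],
   so it is locally uniform there and continuity passes to the limit. *)
assert (zc : forall i t, continuous (z i) t).
{ intros i t; apply continuity_pt_filterlim; intros e He.
  set (W := w t + 1).
  assert (HW : 1 <= W) by (unfold W; generalize (weight_ge1 t); lra).
  destruct (small (2 * (C z0 * W)) (e / 3)) as [n Hn]; [nra|lra|].
  assert (wc : continuous w t).
  { apply (ex_derive_continuous w); unfold w; auto_derive; trivial. }
  generalize (picard_iter_continuous z0 n i t); intros ic.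
  apply continuity_pt_filterlim in wc, ic.
  destruct (wc 1 Rlt_0_1) as [d1 [Hd1 H1]].
  destruct (ic (e / 3) ltac:(lra)) as [d2 [Hd2 H2]].
  exists (Rmin d1 d2); split; [apply Rmin_glb_lt; assumption|].
  intros s [Hs1 Hs2].
  generalize (H1 s (conj Hs1 (Rlt_le_trans _ _ _ Hs2 (Rmin_l _ _))))
             (H2 s (conj Hs1 (Rlt_le_trans _ _ _ Hs2 (Rmin_r _ _)))).
  simpl; unfold Rdist; intros h1 h2.
  apply Rabs_def2 in h1.
  assert (He1 : forall r, w r <= W -> Rabs (z i r - picard_iter z0 n i r) < e / 3).
  { intros r Hr; eapply Rle_lt_trans; [apply Hz|].
    eapply Rle_lt_trans; [|exact Hn].
    assert (0 < (/ 2) ^ n) by (apply pow_lt; lra).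
    apply Rmult_le_compat_r; [lra|]; apply Rmult_le_compat_l; [lra|];
    apply Rmult_le_compat_l; auto. }
  generalize (He1 s ltac:(unfold W; lra)) (He1 t ltac:(unfold W; lra)); intros g1 g2.
  apply Rabs_def2 in g1, g2, h2; apply Rabs_def1; lra. }
assert (fc : forall i t, continuous (fun s => f i (z true s) (z false s)) t)
  by (intros; apply lipschitz_continuous_comp; apply zc).
(* Both [z] and its image [X] under the Picard operator are limits of the same iterates: [X] is
   compared with iterate [n + 1] by applying the contraction estimate to [z] and iterate [n]. *)
assert (Heq : forall i t, z i t = z0 i + RInt (fun s => f i (z true s) (z false s)) 0 t).
{ intros i t.
  set (X := fun t => z0 i + RInt (fun s => f i (z true s) (z false s)) 0 t).
  change (z i t = X t).
  assert (HX : forall n, Rabs (X t - picard_iter z0 (S n) i t) <= C z0 * (/ 2) ^ n * w t).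
  { intros n.
    apply (derive_exp_bound (fun t => X t - picard_iter z0 (S n) i t)
      (fun t => f i (z true t) (z false t)
                - f i (picard_iter z0 n true t) (picard_iter z0 n false t))); auto.
    - unfold K; lra.
    - rewrite picard_iter_0; unfold X; rewrite RInt_point; unfold zero; simpl; ring.
    - intros s; refine (is_derive_minus _ _ _ _ _ _ _);
        [refine (derive_integral _ _ _ _); apply fc|apply picard_iter_derive].
    - intros s; eapply Rle_trans; [apply f_lip|].
      generalize (Hz true s n) (Hz false s n); fold (w s); unfold K; intros h1 h2.
      apply Rle_trans with (L * (4 * (C z0 * (/ 2) ^ n * w s))); [|right; field].
      apply Rmult_le_compat_l; lra. }
  apply cond_eq; intros e He.
  generalize (weight_ge1 t); intros Hw.
  destruct (small (2 * (C z0 * w t)) e) as [n Hn]; [nra|lra|].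
  generalize (HX n) (Hz i t (S n)); simpl pow; intros h1 h2.
  replace (z i t - X t) with ((z i t - picard_iter z0 (S n) i t) - (X t - picard_iter z0 (S n) i t))
    by ring.
  eapply Rle_lt_trans; [apply Rabs_triang|]; rewrite Rabs_Ropp; lra. }
exists z; intros i; split.
- rewrite Heq, RInt_point; apply Rplus_0_r.
- intros t; apply (is_derive_ext (fun t => z0 i + RInt (fun s => f i (z true s) (z false s)) 0 t)).
  + intros s; symmetry; apply Heq.
  + refine (derive_integral _ _ _ _); apply fc.
Qed.

(** A Gronwall argument for the squared distance [E], which satisfies [|E'| <= 4 L E] and [E 0 = 0]:
    the function [E exp (- 4 L t)] is nonincreasing for positive times and [E exp (4 L t)] is
    nondecreasing for negative ones, so [E] cannot become positive. *)
Lemma lipschitz_ode_unique (z u : bool -> R -> R) :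
  (forall i t, is_derive (z i) t (f i (z true t) (z false t))) ->
  (forall i t, is_derive (u i) t (f i (u true t) (u false t))) ->
  (forall i, z i 0 = u i 0) -> forall i t, z i t = u i t.
Proof.
intros Hz Hu H0.
set (E := fun t => (z true t - u true t) ^ 2 + (z false t - u false t) ^ 2).
pose (dE := fun t =>
  2 * (z true t - u true t) * (f true (z true t) (z false t) - f true (u true t) (u false t))
  + 2 * (z false t - u false t) * (f false (z true t) (z false t) - f false (u true t) (u false t))).
assert (HE : forall t, is_derive E t (dE t)).
{ intros t; apply @is_derive_plus; apply is_derive_sqr_diff; auto. }
assert (HE0 : E 0 = 0) by (unfold E; rewrite !H0; ring).
assert (HdE : forall t, Rabs (dE t) <= 4 * L * E t).
{ intros t; unfold dE, E.
  generalize (f_lip true (z true t) (z false t) (u true t) (u false t))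
             (f_lip false (z true t) (z false t) (u true t) (u false t)).
  set (p := f true _ _ - _); set (q := f false _ _ - _).
  set (a := z true t - u true t); set (b := z false t - u false t); intros h1 h2.
  eapply Rle_trans; [apply Rabs_triang|]; rewrite !Rabs_mult, (Rabs_pos_eq 2) by lra.
  rewrite <- (pow2_abs a), <- (pow2_abs b).
  generalize (Rabs_pos a) (Rabs_pos b) h1 h2.
  generalize (Rabs a) (Rabs b) (Rabs p) (Rabs q); intros a' b' p' q' ha hb g1 g2.
  apply Rle_trans with (2 * a' * (L * (a' + b')) + 2 * b' * (L * (a' + b'))).
  (* The two sides are [2 L (a' + b')^2] and [4 L (a'^2 + b'^2)]; they differ by
     [2 L (a' - b')^2]. *)
  2: { assert (0 <= L * (a' - b') ^ 2) by (apply Rmult_le_pos; [lra|apply pow2_ge_0]). nra. }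
  apply Rplus_le_compat; apply Rmult_le_compat_l; lra. }
assert (Hzero : forall t, E t <= 0).
{ intros t; destruct (Rle_dec 0 t) as [h|h].
  - assert (Hm : - (E 0 * exp (- (4 * L) * 0)) <= - (E t * exp (- (4 * L) * t))).
    { apply (derive_nonneg_le (fun t => - (E t * exp (- (4 * L) * t)))
        (fun t => (4 * L * E t - dE t) * exp (- (4 * L) * t))); auto.
      - intros s _; auto_derive; [eexists; apply HE|].
        replace (Derive (fun x => E x) s) with (dE s)
          by (symmetry; apply is_derive_unique; exact (HE s)); ring.
      - intros s _; apply Rmult_le_pos; [|left; apply exp_pos].
        generalize (HdE s) (Rle_abs (dE s)); lra. }
    generalize (exp_pos (- (4 * L) * t)); rewrite HE0 in Hm; nra.
  - assert (Hm : E t * exp ((4 * L) * t) <= E 0 * exp ((4 * L) * 0)).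
    { apply (derive_nonneg_le (fun t => E t * exp ((4 * L) * t))
        (fun t => (4 * L * E t + dE t) * exp ((4 * L) * t))); try lra.
      - intros s _; auto_derive; [eexists; apply HE|].
        replace (Derive (fun x => E x) s) with (dE s)
          by (symmetry; apply is_derive_unique; exact (HE s)); ring.
      - intros s _; apply Rmult_le_pos; [|left; apply exp_pos].
        generalize (HdE s) (Rle_abs (- dE s)); rewrite Rabs_Ropp; lra. }
    generalize (exp_pos ((4 * L) * t)); rewrite HE0 in Hm; nra. }
intros i t; generalize (Hzero t); unfold E; intros h.
generalize (pow2_ge_0 (z true t - u true t)) (pow2_ge_0 (z false t - u false t)); intros h1 h2.
destruct i; apply Rminus_diag_uniq; apply Rsqr_eq_0; rewrite Rsqr_pow2; lra.
Qed.

End PlanarODE.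

(** * Calculus of bounded Lipschitz functions of two variables *)

Definition lipschitz2 (f : R -> R -> R) :=
  exists L, 0 <= L /\ forall x y u v, Rabs (f x y - f u v) <= L * (Rabs (x - u) + Rabs (y - v)).

Definition bounded2 (f : R -> R -> R) := exists B, 0 <= B /\ forall x y, Rabs (f x y) <= B.

(** The two properties are carried together because the Lipschitz estimate for a product uses bounds
    on the factors. *)
Definition bounded_lip (f : R -> R -> R) := bounded2 f /\ lipschitz2 f.

Lemma bounded_lip_const c : bounded_lip (fun _ _ => c).
Proof.
split.
- exists (Rabs c); split; [apply Rabs_pos|intros; lra].
- exists 0; split; [lra|intros x y u v]; rewrite Rminus_diag, Rabs_R0; lra.
Qed.

Lemma lipschitz2_plus f g : lipschitz2 f -> lipschitz2 g -> lipschitz2 (fun x y => f x y + g x y).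
Proof.
intros [L1 [H1 K1]] [L2 [H2 K2]]; exists (L1 + L2); split; [lra|intros x y u v].
replace (f x y + g x y - (f u v + g u v)) with ((f x y - f u v) + (g x y - g u v)) by ring.
eapply Rle_trans; [apply Rabs_triang|].
generalize (K1 x y u v) (K2 x y u v); lra.
Qed.

Lemma bounded_lip_plus f g : bounded_lip f -> bounded_lip g -> bounded_lip (fun x y => f x y + g x y).
Proof.
intros [[B1 [H1 K1]] Lf] [[B2 [H2 K2]] Lg]; split; [|apply lipschitz2_plus; assumption].
exists (B1 + B2); split; [lra|intros x y].
eapply Rle_trans; [apply Rabs_triang|].
generalize (K1 x y) (K2 x y); lra.
Qed.

Lemma bounded_lip_mult f g : bounded_lip f -> bounded_lip g -> bounded_lip (fun x y => f x y * g x y).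
Proof.
intros [[B1 [H1 K1]] [L1 [I1 J1]]] [[B2 [H2 K2]] [L2 [I2 J2]]]; split.
- exists (B1 * B2); split; [nra|intros x y].
  rewrite Rabs_mult; apply Rmult_le_compat; auto using Rabs_pos.
- exists (L1 * B2 + B1 * L2); split; [nra|intros x y u v].
  replace (f x y * g x y - f u v * g u v)
    with ((f x y - f u v) * g x y + f u v * (g x y - g u v)) by ring.
  eapply Rle_trans; [apply Rabs_triang|]; rewrite !Rabs_mult.
  rewrite Rmult_plus_distr_r; apply Rplus_le_compat.
  + replace (L1 * B2 * (Rabs (x - u) + Rabs (y - v)))
      with (L1 * (Rabs (x - u) + Rabs (y - v)) * B2) by ring.
    apply Rmult_le_compat; auto using Rabs_pos.
  + rewrite Rmult_assoc; apply Rmult_le_compat; auto using Rabs_pos.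
Qed.

Lemma bounded_lip_minus f g : bounded_lip f -> bounded_lip g -> bounded_lip (fun x y => f x y - g x y).
Proof.
intros Hf Hg.
destruct (bounded_lip_plus _ _ Hf (bounded_lip_mult _ _ (bounded_lip_const (-1)) Hg))
  as [[B [HB H1]] [L [HL H2]]].
split; [exists B|exists L]; (split; [assumption|]).
- intros x y; replace (f x y - g x y) with (f x y + -1 * g x y) by ring; auto.
- intros x y u v; replace (f x y - g x y - (f u v - g u v))
    with (f x y + -1 * g x y - (f u v + -1 * g u v)) by ring; auto.
Qed.

Lemma bounded_lip_sin : bounded_lip (fun x _ => sin x).
Proof.
split.
- exists 1; split; [lra|intros x _; apply Rabs_le, SIN_bound].
- exists 1; split; [lra|intros x y u v].
  apply Rle_trans with (1 * Rabs (x - u)); [|generalize (Rabs_pos (y - v)); lra].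
  apply (bounded_variation sin cos); intros t _; split; [apply is_derive_sin|apply Rabs_le, COS_bound].
Qed.

Lemma bounded_lip_cos : bounded_lip (fun x _ => cos x).
Proof.
split.
- exists 1; split; [lra|intros x _; apply Rabs_le, COS_bound].
- exists 1; split; [lra|intros x y u v].
  apply Rle_trans with (1 * Rabs (x - u)); [|generalize (Rabs_pos (y - v)); lra].
  apply (bounded_variation cos (fun t => - sin t)); intros t _; split; [apply is_derive_cos|].
  rewrite Rabs_Ropp; apply Rabs_le, SIN_bound.
Qed.

Lemma Rmax_lip a b e : Rabs (Rmax a e - Rmax b e) <= Rabs (a - b).
Proof. unfold Rmax, Rabs; repeat destruct Rle_dec; repeat destruct Rcase_abs; lra. Qed.

Lemma lipschitz2_Rmax f e : lipschitz2 f -> lipschitz2 (fun x y => Rmax (f x y) e).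
Proof.
intros [L [HL H]]; exists L; split; [assumption|intros x y u v].
eapply Rle_trans; [apply Rmax_lip|apply H].
Qed.

Lemma bounded_lip_inv f e :
  0 < e -> (forall x y, e <= f x y) -> lipschitz2 f -> bounded_lip (fun x y => / f x y).
Proof.
intros He Hf [L [HL H]]; split.
- exists (/ e); split; [left; apply Rinv_0_lt_compat; assumption|intros x y].
  generalize (Hf x y); intros h.
  rewrite Rabs_pos_eq; [apply Rinv_le_contravar; lra|left; apply Rinv_0_lt_compat; lra].
- exists (/ e * L * / e).
  assert (Hie : 0 < / e) by (apply Rinv_0_lt_compat; assumption).
  split; [repeat apply Rmult_le_pos; lra|intros x y u v].
  generalize (Hf x y) (Hf u v); intros h1 h2.
  replace (/ f x y - / f u v) with (/ f x y * (- (f x y - f u v)) * / f u v) by (field; lra).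
  rewrite !Rabs_mult, Rabs_Ropp, (Rabs_pos_eq (/ f x y)), (Rabs_pos_eq (/ f u v))
    by (left; apply Rinv_0_lt_compat; lra).
  replace (/ e * L * / e * (Rabs (x - u) + Rabs (y - v)))
    with (/ e * (L * (Rabs (x - u) + Rabs (y - v))) * / e) by ring.
  apply Rmult_le_compat.
  + apply Rmult_le_pos; [left; apply Rinv_0_lt_compat; lra|apply Rabs_pos].
  + left; apply Rinv_0_lt_compat; lra.
  + apply Rmult_le_compat; try apply Rabs_pos.
    * left; apply Rinv_0_lt_compat; lra.
    * apply Rinv_le_contravar; lra.
    * apply H.
  + apply Rinv_le_contravar; lra.
Qed.

(** This is the triangle inequality for the Euclidean norm, with the increment measured by the sum
    of absolute values. After squaring, the cross terms are controlled by the fact that each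
    coordinate is at most the norm. *)
Lemma sqrt_sum_sqr_lip a b u v :
  Rabs (sqrt (a ^ 2 + b ^ 2) - sqrt (u ^ 2 + v ^ 2)) <= Rabs (a - u) + Rabs (b - v).
Proof.
assert (main : forall a b u v,
  sqrt (a ^ 2 + b ^ 2) <= sqrt (u ^ 2 + v ^ 2) + Rabs (a - u) + Rabs (b - v)).
{ clear; intros a b u v.
  generalize (sqrt_pos (u ^ 2 + v ^ 2)) (Rabs_pos (a - u)) (Rabs_pos (b - v)); intros h0 h1 h2.
  assert (hs : sqrt (u ^ 2 + v ^ 2) * sqrt (u ^ 2 + v ^ 2) = u ^ 2 + v ^ 2)
    by (apply sqrt_sqrt; generalize (pow2_ge_0 u) (pow2_ge_0 v); lra).
  assert (hu : Rabs u <= sqrt (u ^ 2 + v ^ 2)).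
  { rewrite <- sqrt_Rsqr_abs; apply sqrt_le_1_alt; unfold Rsqr; nra. }
  assert (hv : Rabs v <= sqrt (u ^ 2 + v ^ 2)).
  { rewrite <- sqrt_Rsqr_abs; apply sqrt_le_1_alt; unfold Rsqr; nra. }
  rewrite <- (sqrt_Rsqr (sqrt (u ^ 2 + v ^ 2) + Rabs (a - u) + Rabs (b - v))) by lra.
  apply sqrt_le_1_alt; unfold Rsqr.
  generalize (pow2_abs (a - u)) (pow2_abs (b - v)); intros e1 e2.
  assert (c1 : u * (a - u) <= sqrt (u ^ 2 + v ^ 2) * Rabs (a - u)).
  { eapply Rle_trans; [apply Rle_abs|]; rewrite Rabs_mult; nra. }
  assert (c2 : v * (b - v) <= sqrt (u ^ 2 + v ^ 2) * Rabs (b - v)).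
  { eapply Rle_trans; [apply Rle_abs|]; rewrite Rabs_mult; nra. }
  nra. }
generalize (main a b u v) (main u v a b).
rewrite (Rabs_minus_sym u a), (Rabs_minus_sym v b).
intros; apply Rabs_le; lra.
Qed.

Lemma lipschitz2_sqrt_sum_sqr f : lipschitz2 f -> lipschitz2 (fun x y => sqrt (f x y ^ 2 + y ^ 2)).
Proof.
intros [L [HL H]]; exists (L + 1); split; [lra|intros x y u v].
eapply Rle_trans; [apply sqrt_sum_sqr_lip|].
generalize (H x y u v) (Rabs_pos (x - u)) (Rabs_pos (y - v)); lra.
Qed.

(** The factor [y] alone is unbounded, so the product rule does not apply to it; the quotient is
    bounded by 1 because [f] dominates [|y|]. This handles the numerator [W] of [F1]. *)
Lemma bounded_lip_snd_div f e :
  0 < e -> (forall x y, e <= f x y) -> (forall x y, Rabs y <= f x y) -> lipschitz2 f ->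
  bounded_lip (fun x y => y * / f x y).
Proof.
intros He Hf Hy [L [HL H]]; split.
- exists 1; split; [lra|intros x y].
  generalize (Hf x y); intros h.
  rewrite Rabs_mult, (Rabs_pos_eq (/ f x y)) by (left; apply Rinv_0_lt_compat; lra).
  apply Rmult_le_reg_r with (f x y); [lra|].
  rewrite Rmult_assoc, Rinv_l by lra; generalize (Hy x y); lra.
- exists ((1 + L) * / e).
  assert (Hie : 0 < / e) by (apply Rinv_0_lt_compat; assumption).
  split; [apply Rmult_le_pos; lra|intros x y u v].
  generalize (Hf x y) (Hf u v) (Hy u v) (H x y u v); intros h1 h2 h3 h4.
  replace (y * / f x y - v * / f u v)
    with (((y - v) + (v * / f u v) * (- (f x y - f u v))) * / f x y) by (field; lra).
  assert (h5 : Rabs (v * / f u v) <= 1).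
  { rewrite Rabs_mult, (Rabs_pos_eq (/ f u v)) by (left; apply Rinv_0_lt_compat; lra).
    apply Rmult_le_reg_r with (f u v); [lra|].
    rewrite Rmult_assoc, Rinv_l by lra; lra. }
  rewrite Rabs_mult, (Rabs_pos_eq (/ f x y)) by (left; apply Rinv_0_lt_compat; lra).
  replace ((1 + L) * / e * (Rabs (x - u) + Rabs (y - v)))
    with (((1 + L) * (Rabs (x - u) + Rabs (y - v))) * / e) by ring.
  apply Rmult_le_compat; [apply Rabs_pos|left; apply Rinv_0_lt_compat; lra| |
    apply Rinv_le_contravar; lra].
  eapply Rle_trans; [apply Rabs_triang|]; rewrite Rabs_mult, Rabs_Ropp.
  generalize (Rabs_pos (x - u)) (Rabs_pos (v * / f u v)) (Rabs_pos (f x y - f u v)); nra.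
Qed.

(** * The leapfrogging system *)

Section Leapfrog.
Context (alpha d beta : R) (Ha : 0 < alpha) (Hd : 0 < d) (Hb : 1 <= beta).

Let b := sqrt beta.
Let A := alpha * b.
Let tb := theta_b beta.

(* [p] and [rho] turn [D_beta] into [p^2 + W^2 = rho^2]; [G] is the part of the Hamiltonian that
   depends on theta only, and [k0 = - G']. *)
Definition p x := d / b * (b * sin x - cos x).
Definition dp x := d / b * (b * cos x + sin x).
Definition rho x y := sqrt (p x ^ 2 + y ^ 2).
Definition k0 x := / d * (beta * b * / cos x - / sin x).
Definition G x := / (2 * d) *
  (beta * b * (ln (1 - sin x) - ln (1 + sin x)) + (ln (1 - cos x) - ln (1 + cos x))).
Definition energy x y := G x - A / rho x y.

Lemma b_ge1 : 1 <= b.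
Proof. unfold b; rewrite <- sqrt_1; apply sqrt_le_1_alt; assumption. Qed.

Lemma b_sqr : b * b = beta.
Proof. apply sqrt_sqrt; lra. Qed.

Lemma A_pos : 0 < A.
Proof. generalize b_ge1; unfold A; intros; apply Rmult_lt_0_compat; lra. Qed.

Lemma betab_ge1 : 1 <= beta * b.
Proof. generalize b_ge1; nra. Qed.

Lemma Dbeta_eq x y : Dbeta d beta x y = p x ^ 2 + y ^ 2.
Proof.
unfold Dbeta, p; fold b; rewrite <- b_sqr; generalize b_ge1; intros; field; lra.
Qed.

Lemma sum_sqr_ge0 x y : 0 <= p x ^ 2 + y ^ 2.
Proof. generalize (pow2_ge_0 (p x)) (pow2_ge_0 y); lra. Qed.

Lemma rho_sqr x y : rho x y ^ 2 = p x ^ 2 + y ^ 2.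
Proof. unfold rho; apply pow2_sqrt, sum_sqr_ge0. Qed.

Lemma F1_eq x y : F1 alpha d beta x y = A * y / rho x y ^ 3.
Proof.
unfold F1; rewrite Dbeta_eq; fold (rho x y) b A.
rewrite <- rho_sqr; unfold Rdiv; f_equal; f_equal; ring.
Qed.

Lemma F2_eq x y : 0 < x < PI / 2 -> 0 < rho x y ->
  F2 alpha d beta x y = k0 x - A * p x * dp x / rho x y ^ 3.
Proof.
intros Hx Hr; generalize b_ge1; intros hb.
unfold F2; rewrite Dbeta_eq; fold (rho x y) b.
rewrite <- rho_sqr.
assert (0 < sin x) by (apply sin_gt_0; lra).
assert (0 < cos x) by (apply cos_gt_0; lra).
unfold k0, A, p, dp; field; repeat split; lra.
Qed.

Lemma sin_cos_lt1 x : 0 < x < PI / 2 -> 0 < sin x < 1 /\ 0 < cos x < 1.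
Proof.
intros Hx; assert (hs : 0 < sin x) by (apply sin_gt_0; lra).
assert (hc : 0 < cos x) by (apply cos_gt_0; lra).
generalize (sin2_cos2 x); unfold Rsqr; nra.
Qed.

Lemma Ham_eq x y : 0 < x < PI / 2 -> Ham alpha d beta x y = energy x y.
Proof.
intros Hx; destruct (sin_cos_lt1 x Hx) as [Hs Hc].
unfold Ham, energy; rewrite Dbeta_eq; fold (rho x y) b A.
unfold G; f_equal; f_equal.
rewrite ln_div, !ln_mult, !ln_Rpower; try lra;
  try (apply Rmult_lt_0_compat); try lra; try apply exp_pos.
Qed.

Lemma tb_bounds : 0 < tb < PI / 2.
Proof.
unfold tb, theta_b; fold b; split; [|apply atan_bound].
rewrite <- atan_0; apply atan_increasing, Rinv_0_lt_compat; generalize b_ge1; lra.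
Qed.

Lemma dp_pos x : 0 <= x <= PI / 2 -> 0 < dp x.
Proof.
intros Hx; generalize b_ge1; intros hb.
assert (hs : 0 <= sin x) by (apply sin_ge_0; lra).
assert (hc : 0 <= cos x) by (apply cos_ge_0; lra).
generalize (sin2_cos2 x); unfold Rsqr; intros e.
apply Rmult_lt_0_compat; [apply Rdiv_lt_0_compat; lra|].
destruct (Rle_lt_or_eq_dec _ _ hs) as [h|h]; nra.
Qed.

Lemma p_derive x : is_derive p x (dp x).
Proof. unfold p, dp; auto_derive; trivial; ring. Qed.

Lemma p_incr x y : 0 <= x -> x < y -> y <= PI / 2 -> p x < p y.
Proof.
intros; apply (incr_function_le p 0 (PI / 2) dp); simpl; auto; intros.
- apply p_derive.
- apply dp_pos; split; assumption.
Qed.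

Lemma p_tb : p tb = 0.
Proof.
generalize b_ge1 tb_bounds; intros hb htb.
assert (hc : 0 < cos tb) by (apply cos_gt_0; lra).
assert (e : tan tb = / b) by apply tan_atan.
unfold tan in e.
assert (sin tb = cos tb * / b) by (rewrite <- e; field; lra).
unfold p; rewrite H; field; lra.
Qed.

Lemma p_neg x : 0 <= x < tb -> p x < 0.
Proof. intros; rewrite <- p_tb; apply p_incr; generalize tb_bounds; lra. Qed.

Lemma p_pos x : tb < x <= PI / 2 -> 0 < p x.
Proof. intros; rewrite <- p_tb; apply p_incr; generalize tb_bounds; lra. Qed.

Lemma rho_pos x y : in_Omega beta x y -> 0 < rho x y.
Proof.
intros [Hx Hn]; apply sqrt_lt_R0.
generalize (pow2_ge_0 (p x)) (pow2_ge_0 y); intros h1 h2.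
destruct (Req_dec y 0) as [hy|hy].
- subst y; assert (hp : p x <> 0).
  { destruct (Rtotal_order x tb) as [h|[h|h]].
    - generalize (p_neg x); lra.
    - exfalso; apply Hn; split; [exact h|reflexivity].
    - generalize (p_pos x); lra. }
  generalize (pow_nonzero _ 2 hp); lra.
- generalize (pow_nonzero _ 2 hy); lra.
Qed.

Lemma rho_pos_Omega x y : 0 < x < PI / 2 -> 0 < rho x y -> in_Omega beta x y.
Proof.
intros Hx Hr; split; [assumption|intros [-> ->]].
unfold rho in Hr; fold tb in Hr; rewrite p_tb in Hr.
replace (0 ^ 2 + 0 ^ 2) with 0 in Hr by ring; rewrite sqrt_0 in Hr; lra.
Qed.

Lemma rho_axis x : rho x 0 = Rabs (p x).
Proof. unfold rho; rewrite <- sqrt_Rsqr_abs; f_equal; unfold Rsqr; ring. Qed.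

Lemma rho_ge_axis x y : Rabs (p x) <= rho x y.
Proof. rewrite <- rho_axis; apply sqrt_le_1_alt; generalize (pow2_ge_0 y); lra. Qed.

Lemma rho_ge_abs x y : Rabs y <= rho x y.
Proof.
unfold rho; rewrite <- (sqrt_Rsqr_abs y); apply sqrt_le_1_alt; unfold Rsqr.
generalize (pow2_ge_0 (p x)); lra.
Qed.

Lemma G_derive x : 0 < x < PI / 2 -> is_derive G x (- k0 x).
Proof.
intros Hx; destruct (sin_cos_lt1 x Hx) as [Hs Hc].
unfold G, k0; auto_derive; [lra|].
generalize (sin2_cos2 x); unfold Rsqr; intros e.
transitivity (/ (2 * d) * (beta * b * (- cos x * 2 / ((1 - sin x) * (1 + sin x)))
  + sin x * 2 / ((1 - cos x) * (1 + cos x)))); [field; lra|].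
replace ((1 - sin x) * (1 + sin x)) with (cos x * cos x) by lra.
replace ((1 - cos x) * (1 + cos x)) with (sin x * sin x) by lra.
field; lra.
Qed.

Lemma energy_derive (x y : R -> R) (dx dy t : R) :
  0 < x t < PI / 2 -> 0 < rho (x t) (y t) -> is_derive x t dx -> is_derive y t dy ->
  is_derive (fun s => energy (x s) (y s)) t
    (- k0 (x t) * dx + A * (p (x t) * dp (x t) * dx + y t * dy) / rho (x t) (y t) ^ 3).
Proof.
intros Hx Hr Hdx Hdy.
assert (HG : is_derive (fun s => G (x s)) t (- k0 (x t) * dx)).
{ evar_last; [apply (is_derive_comp G x t _ _ (G_derive _ Hx) Hdx)|].
  unfold scal; simpl; unfold mult; simpl; ring. }
assert (Hp : is_derive (fun s => p (x s)) t (dp (x t) * dx)).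
{ evar_last; [apply (is_derive_comp p x t _ _ (p_derive _) Hdx)|].
  unfold scal; simpl; unfold mult; simpl; ring. }
assert (HR : is_derive (fun s => A / rho (x s) (y s)) t
  (- (A * (p (x t) * dp (x t) * dx + y t * dy) / rho (x t) (y t) ^ 3))).
{ unfold rho.
  set (P := fun s => p (x s)); change (is_derive P t (dp (x t) * dx)) in Hp.
  assert (Hpos : 0 < P t ^ 2 + y t ^ 2).
  { change (P t) with (p (x t)); rewrite <- rho_sqr; apply pow_lt; assumption. }
  change (is_derive (fun s => A / sqrt (P s ^ 2 + y s ^ 2)) t
    (- (A * (P t * dp (x t) * dx + y t * dy) / sqrt (P t ^ 2 + y t ^ 2) ^ 3))).
  assert (HS : is_derive (fun s => P s ^ 2 + y s ^ 2) t (2 * (P t * dp (x t) * dx + y t * dy))).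
  { clearbody P; auto_derive; [repeat split; eexists; eassumption|].
    replace (Derive (fun x => P x) t) with (dp (x t) * dx)
      by (symmetry; apply is_derive_unique; exact Hp).
    replace (Derive (fun x => y x) t) with dy by (symmetry; apply is_derive_unique; exact Hdy).
    ring. }
  set (S := fun s => P s ^ 2 + y s ^ 2).
  change (is_derive S t (2 * (P t * dp (x t) * dx + y t * dy))) in HS.
  change (is_derive (fun s => A / sqrt (S s)) t
    (- (A * (P t * dp (x t) * dx + y t * dy) / sqrt (S t) ^ 3))).
  change (0 < S t) in Hpos.
  assert (hq : 0 < sqrt (S t)) by (apply sqrt_lt_R0; assumption).
  clearbody S; auto_derive; [repeat split; try lra; eexists; eassumption|].
  replace (Derive (fun x => S x) t) with (2 * (P t * dp (x t) * dx + y t * dy))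
    by (symmetry; apply is_derive_unique; exact HS).
  field; lra. }
unfold energy; evar_last; [apply @is_derive_minus; [exact HG|exact HR]|].
unfold minus, plus, opp; simpl; ring.
Qed.

Lemma energy_conserved (x y : R -> R) (t : R) :
  0 < x t < PI / 2 -> 0 < rho (x t) (y t) ->
  is_derive x t (F1 alpha d beta (x t) (y t)) ->
  is_derive y t (F2 alpha d beta (x t) (y t)) ->
  is_derive (fun s => energy (x s) (y s)) t 0.
Proof.
intros Hx Hr Hdx Hdy; evar_last; [apply energy_derive; eassumption|].
rewrite F2_eq, F1_eq by assumption; field; lra.
Qed.

(** * Energy levels, a priori bounds, uniqueness and global existence *)

Lemma energy_solution x y : is_solution alpha d beta x y ->
  forall t, energy (x t) (y t) = energy (x 0) (y 0).
Proof.
intros Hs t; apply (derive_zero_eq (fun t => energy (x t) (y t))); intros r _.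
destruct (Hs r) as [H0 [H1 H2]].
apply (energy_conserved x y).
- apply H0.
- apply rho_pos; assumption.
- apply is_derive_Reals; assumption.
- apply is_derive_Reals; assumption.
Qed.

(** From [(1 - sin x) (1 + sin x) = cos^2 x] and its counterpart for [cos], one gets [d G = beta b
    (ln cos - ln (1 + sin)) + (ln sin - ln (1 + cos))]. Both brackets are negative and
    [beta b >= 1], so dropping terms leaves [ln sin] or [ln cos] as upper bounds. *)
Lemma G_lt_ln x : 0 < x < PI / 2 -> G x < 0 /\ d * G x < ln (sin x) /\ d * G x < ln (cos x).
Proof.
intros Hx; destruct (sin_cos_lt1 x Hx) as [Hs Hc].
generalize betab_ge1; intros hbb.
assert (l1 : ln (sin x) < 0) by (rewrite <- ln_1; apply ln_increasing; lra).
assert (l2 : ln (cos x) < 0) by (rewrite <- ln_1; apply ln_increasing; lra).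
assert (l3 : 0 < ln (1 + sin x)) by (rewrite <- ln_1; apply ln_increasing; lra).
assert (l4 : 0 < ln (1 + cos x)) by (rewrite <- ln_1; apply ln_increasing; lra).
generalize (sin2_cos2 x); unfold Rsqr; intros e.
assert (l5 : ln (1 - sin x) + ln (1 + sin x) = ln (cos x) + ln (cos x)).
{ rewrite <- !ln_mult by lra; f_equal; lra. }
assert (l6 : ln (1 - cos x) + ln (1 + cos x) = ln (sin x) + ln (sin x)).
{ rewrite <- !ln_mult by lra; f_equal; lra. }
assert (m : d * G x = beta * b * (ln (cos x) - ln (1 + sin x)) + (ln (sin x) - ln (1 + cos x))).
{ unfold G; replace (ln (1 - sin x)) with (ln (cos x) + ln (cos x) - ln (1 + sin x)) by lra.
  replace (ln (1 - cos x)) with (ln (sin x) + ln (sin x) - ln (1 + cos x)) by lra.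
  field; lra. }
assert (n : beta * b * (ln (cos x) - ln (1 + sin x)) <= 1 * (ln (cos x) - ln (1 + sin x)))
  by nra.
assert (d * G x < 0) by lra.
repeat split; try lra; nra.
Qed.

(** Both summands [G] and [- A / rho] are negative, so each is larger than the energy. The first
    then bounds [sin] and [cos] from below through [G_lt_ln], the second bounds [rho]. *)
Lemma level_bounds x y : in_Omega beta x y ->
  energy x y < 0 /\ exp (d * energy x y) < sin x /\ exp (d * energy x y) < cos x /\
  A / - energy x y < rho x y.
Proof.
intros Hin; destruct (Hin) as [Hx _]; generalize (rho_pos x y Hin) A_pos; intros hr hA.
destruct (G_lt_ln x Hx) as [g0 [g1 g2]]; destruct (sin_cos_lt1 x Hx) as [Hs Hc].
assert (h : 0 < A / rho x y) by (apply Rdiv_lt_0_compat; assumption).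
assert (hE : energy x y < G x) by (unfold energy; lra).
assert (hdE : d * energy x y < d * G x) by (apply Rmult_lt_compat_l; lra).
repeat split.
- lra.
- rewrite <- (exp_ln (sin x)) by lra; apply exp_increasing; lra.
- rewrite <- (exp_ln (cos x)) by lra; apply exp_increasing; lra.
- apply Rmult_lt_reg_r with (- energy x y); [lra|].
  unfold Rdiv; rewrite Rmult_assoc, Rinv_l, Rmult_1_r by lra.
  apply Rle_lt_trans with (rho x y * (A / rho x y)).
  + right; field; lra.
  + apply Rmult_lt_compat_l; [lra|]; unfold energy; lra.
Qed.

(** Every denominator is cut off at the lower bound that [level_bounds] gives on the level [c], so
    the field is unchanged on that level. The factor [y * / m] is grouped first to match
    [bounded_lip_snd_div]. *)
Definition trunc_field (c : R) (i : bool) (x y : R) : R :=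
  let m := Rmax (rho x y) (A / - c) in
  if i then A * (y * / m) * / m * / m
  else / d * (beta * b * / Rmax (cos x) (exp (d * c)) - / Rmax (sin x) (exp (d * c)))
       - A * p x * dp x * / m * / m * / m.

Lemma bounded_lip_p : bounded_lip (fun x _ => p x).
Proof.
unfold p; apply (bounded_lip_mult (fun _ _ => d / b)); [apply bounded_lip_const|].
apply bounded_lip_minus; [|apply bounded_lip_cos].
apply (bounded_lip_mult (fun _ _ => b)); [apply bounded_lip_const|apply bounded_lip_sin].
Qed.

Lemma bounded_lip_dp : bounded_lip (fun x _ => dp x).
Proof.
unfold dp; apply (bounded_lip_mult (fun _ _ => d / b)); [apply bounded_lip_const|].
apply bounded_lip_plus; [|apply bounded_lip_sin].
apply (bounded_lip_mult (fun _ _ => b)); [apply bounded_lip_const|apply bounded_lip_cos].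
Qed.

Lemma lipschitz2_trunc_rho e : lipschitz2 (fun x y => Rmax (rho x y) e).
Proof. apply lipschitz2_Rmax, (lipschitz2_sqrt_sum_sqr (fun x _ => p x)), bounded_lip_p. Qed.

Lemma trunc_field_blip c : c < 0 -> forall i, bounded_lip (trunc_field c i).
Proof.
intros Hc i; generalize A_pos; intros hA.
assert (hm : 0 < A / - c) by (apply Rdiv_lt_0_compat; lra).
assert (hi : bounded_lip (fun x y => / Rmax (rho x y) (A / - c))).
{ apply (bounded_lip_inv _ (A / - c)); [assumption|intros; apply Rmax_r|apply lipschitz2_trunc_rho]. }
assert (trig : forall f : R -> R, bounded_lip (fun x _ => f x) ->
  bounded_lip (fun x _ => / Rmax (f x) (exp (d * c)))).
{ intros f Hf; apply (bounded_lip_inv (fun x _ => Rmax (f x) (exp (d * c))) (exp (d * c)));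
    [apply exp_pos|intros; apply Rmax_r|apply (lipschitz2_Rmax (fun x _ => f x)), Hf]. }
destruct i; unfold trunc_field; cbv zeta.
- assert (hy : forall x y, Rabs y <= Rmax (rho x y) (A / - c))
    by (intros; eapply Rle_trans; [apply rho_ge_abs|apply Rmax_l]).
  apply (bounded_lip_mult _ _ (bounded_lip_mult _ _ (bounded_lip_mult _ _ (bounded_lip_const A)
    (bounded_lip_snd_div _ (A / - c) hm (fun _ _ => Rmax_r _ _) hy (lipschitz2_trunc_rho _))) hi) hi).
- apply (bounded_lip_minus
    (fun x y => / d * (beta * b * / Rmax (cos x) (exp (d * c)) - / Rmax (sin x) (exp (d * c))))).
  + apply (bounded_lip_mult (fun _ _ => / d)); [apply bounded_lip_const|].
    apply (bounded_lip_minus (fun x y => beta * b * / Rmax (cos x) (exp (d * c)))).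
    * apply (bounded_lip_mult (fun _ _ => beta * b)); [apply bounded_lip_const|].
      apply trig, bounded_lip_cos.
    * apply trig, bounded_lip_sin.
  + apply (bounded_lip_mult _ _ (bounded_lip_mult _ _ (bounded_lip_mult _ _
      (bounded_lip_mult _ _ (bounded_lip_mult _ _
      (bounded_lip_const A) bounded_lip_p) bounded_lip_dp) hi) hi) hi).
Qed.

Lemma trunc_field_lipschitz c : c < 0 -> exists L, 1 <= L /\ forall i x y u v,
  Rabs (trunc_field c i x y - trunc_field c i u v) <= L * (Rabs (x - u) + Rabs (y - v)).
Proof.
intros Hc.
destruct (trunc_field_blip c Hc true) as [_ [L1 [H1 K1]]].
destruct (trunc_field_blip c Hc false) as [_ [L2 [H2 K2]]].
exists (1 + L1 + L2); split; [lra|intros i x y u v].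
generalize (Rabs_pos (x - u)) (Rabs_pos (y - v)); intros h1 h2.
destruct i; [eapply Rle_trans; [apply K1|]|eapply Rle_trans; [apply K2|]];
  apply Rmult_le_compat_r; lra.
Qed.

Lemma trunc_field_eq c x y : c < 0 -> 0 < x < PI / 2 ->
  exp (d * c) <= sin x -> exp (d * c) <= cos x -> A / - c <= rho x y ->
  trunc_field c true x y = F1 alpha d beta x y /\ trunc_field c false x y = F2 alpha d beta x y.
Proof.
intros Hc Hx Hs Hco Hr.
assert (hr : 0 < rho x y).
{ apply Rlt_le_trans with (A / - c); [apply Rdiv_lt_0_compat; [apply A_pos|lra]|assumption]. }
destruct (sin_cos_lt1 x Hx).
rewrite F1_eq, F2_eq by assumption.
unfold trunc_field, k0; rewrite !Rmax_left by assumption.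
split; field; lra.
Qed.

Lemma solution_trunc x y : is_solution alpha d beta x y ->
  forall t, is_derive x t (trunc_field (energy (x 0) (y 0)) true (x t) (y t)) /\
            is_derive y t (trunc_field (energy (x 0) (y 0)) false (x t) (y t)).
Proof.
intros Hs t; destruct (Hs t) as [H0 [H1 H2]].
destruct (level_bounds _ _ H0) as [h1 [h2 [h3 h4]]].
rewrite (energy_solution x y Hs t) in *.
destruct (trunc_field_eq (energy (x 0) (y 0)) (x t) (y t)) as [e1 e2]; try lra; [apply H0|].
rewrite e1, e2; split; apply is_derive_Reals; assumption.
Qed.

(** Equal initial data give equal energies, so both curves solve the same truncated, globally
    Lipschitz system. *)
Lemma solution_unique x y u v :
  is_solution alpha d beta x y -> is_solution alpha d beta u v ->
  x 0 = u 0 -> y 0 = v 0 -> forall t, x t = u t /\ y t = v t.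
Proof.
intros Hx Hu e1 e2.
generalize (solution_trunc _ _ Hx) (solution_trunc _ _ Hu).
rewrite <- e1, <- e2; set (c := energy (x 0) (y 0)); intros S1 S2.
destruct (trunc_field_lipschitz c) as [L [HL Hlip]]; [apply level_bounds, Hx|].
pose (z := fun i : bool => if i then x else y).
pose (w := fun i : bool => if i then u else v).
assert (U : forall i t, z i t = w i t).
{ apply (lipschitz_ode_unique (trunc_field c) L HL Hlip).
  - intros [|] t; apply S1.
  - intros [|] t; apply S2.
  - intros [|]; assumption. }
intros t; split; [apply (U true)|apply (U false)].
Qed.

(** The truncated system is solved for all times. As long as its solution stays in the closed region
    where the truncation is inactive, the energy is conserved and [level_bounds] places the point
    strictly inside that region; by [positivity_propagates] it never leaves. *)
Lemma solution_exists x0 y0 : in_Omega beta x0 y0 ->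
  exists x y, is_solution alpha d beta x y /\ x 0 = x0 /\ y 0 = y0.
Proof.
intros Hin.
destruct (level_bounds x0 y0 Hin) as [h1 [h2 [h3 h4]]].
set (c := energy x0 y0) in *.
destruct (trunc_field_lipschitz c h1) as [L [HL Hlip]].
destruct (picard (trunc_field c) L HL Hlip (fun i => if i then x0 else y0)) as [z Hz].
pose (x := z true); pose (y := z false).
assert (x0e : x 0 = x0) by apply (Hz true).
assert (y0e : y 0 = y0) by apply (Hz false).
assert (dx : forall t, is_derive x t (trunc_field c true (x t) (y t))) by apply (Hz true).
assert (dy : forall t, is_derive y t (trunc_field c false (x t) (y t))) by apply (Hz false).
clearbody x y; clear z Hz.
assert (cx : continuity x).
{ intros t; apply continuity_pt_filterlim, (ex_derive_continuous x); eexists; apply dx. }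
assert (cy : continuity y).
{ intros t; apply continuity_pt_filterlim, (ex_derive_continuous y); eexists; apply dy. }
assert (cc : forall k : R, continuity (fun _ => k))
  by (intros k t; apply continuity_pt_const; intros ? ?; reflexivity).
(* The smallest of all margins: [m t >= 0] means that the truncated field agrees with the true one
   at time [t]. *)
pose (m := fun t => Rmin (Rmin (x t) (PI / 2 - x t))
  (Rmin (Rmin (sin (x t) - exp (d * c)) (cos (x t) - exp (d * c))) (rho (x t) (y t) - A / - c))).
assert (cs : continuity (fun t => sin (x t)))
  by (intros t; apply (continuity_pt_comp x sin); [apply cx|apply continuity_sin]).
assert (cco : continuity (fun t => cos (x t)))
  by (intros t; apply (continuity_pt_comp x cos); [apply cx|apply continuity_cos]).
assert (cm : continuity m).
{ repeat apply continuity_Rmin; try apply continuity_minus; auto.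
  intros t.
  apply (continuity_pt_comp (fun t => p (x t) ^ 2 + y t ^ 2) sqrt).
  - apply (continuity_plus (fun t => p (x t) ^ 2) (fun t => y t ^ 2)); intros s.
    + apply (continuity_pt_comp (fun t => p (x t)) (fun u => u ^ 2));
        [|apply derivable_continuous_pt, derivable_pt_pow].
      apply (continuity_mult (fun _ => d / b) (fun t => b * sin (x t) - cos (x t))); auto.
      apply continuity_minus; [apply (continuity_mult (fun _ => b)); auto|auto].
    + apply (continuity_pt_comp y (fun u => u ^ 2));
        [apply cy|apply derivable_continuous_pt, derivable_pt_pow].
  - apply continuity_pt_sqrt, sum_sqr_ge0. }
assert (mE : forall t k, (k <= m t <-> k <= x t /\ k <= PI / 2 - x t /\ k <= sin (x t) - exp (d * c)
  /\ k <= cos (x t) - exp (d * c) /\ k <= rho (x t) (y t) - A / - c)).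
{ intros t k; unfold m, Rmin; repeat destruct Rle_dec; lra. }
(* A nonnegative margin only gives the closed interval; at its endpoints [sin] or [cos] vanishes,
   which is below the threshold [exp (d * c)]. *)
assert (in_range : forall t, 0 <= m t -> 0 < x t < PI / 2).
{ intros t Ht; apply mE in Ht; generalize (exp_pos (d * c)); intros he.
  split; apply Rnot_le_lt; intros k.
  - assert (e : x t = 0) by lra; rewrite e, sin_0 in Ht; lra.
  - assert (e : x t = PI / 2) by lra; rewrite e, cos_PI2 in Ht; lra. }
assert (hA : 0 < A / - c) by (apply Rdiv_lt_0_compat; [apply A_pos|lra]).
assert (field_eq : forall t, 0 <= m t -> in_Omega beta (x t) (y t) /\
  is_derive x t (F1 alpha d beta (x t) (y t)) /\ is_derive y t (F2 alpha d beta (x t) (y t))).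
{ intros t Ht; generalize (in_range t Ht); intros Hr; apply mE in Ht.
  split; [apply rho_pos_Omega; lra|].
  destruct (trunc_field_eq c (x t) (y t)) as [e1 e2]; try lra.
  rewrite <- e1, <- e2; split; auto. }
assert (mpos : forall t, Rlt 0 (m t) <-> 0 < x t /\ 0 < PI / 2 - x t /\ 0 < sin (x t) - exp (d * c)
  /\ 0 < cos (x t) - exp (d * c) /\ 0 < rho (x t) (y t) - A / - c).
{ intros t; unfold m, Rmin; repeat destruct Rle_dec; lra. }
assert (all : forall t, 0 < m t).
{ apply positivity_propagates; [assumption| |].
  - apply mpos; rewrite x0e, y0e; generalize (proj1 Hin); lra.
  - intros t Ht.
    assert (Et : energy (x t) (y t) = c).
    { unfold c; rewrite <- x0e, <- y0e; symmetry.
      apply (derive_zero_eq (fun t => energy (x t) (y t))); intros r Hr.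
      destruct (field_eq r (Ht r Hr)) as [g1 [g2 g3]].
      apply (energy_conserved x y); [apply g1|apply (rho_pos _ _ g1)|exact g2|exact g3]. }
    assert (Hmt : 0 <= m t) by (apply Ht; unfold Rmin, Rmax; destruct Rle_dec; lra).
    destruct (field_eq t Hmt) as [g1 _].
    destruct (level_bounds _ _ g1) as [k1 [k2 [k3 k4]]]; rewrite Et in *.
    apply mpos; generalize (proj1 g1); lra. }
exists x, y; repeat split; auto.
- apply (field_eq t); left; auto.
- apply (field_eq t); left; auto.
- apply (field_eq t); left; auto.
- apply is_derive_Reals, (field_eq t); left; auto.
- apply is_derive_Reals, (field_eq t); left; auto.
Qed.

(** * Equilibria and the energy on the axis *)

Lemma k0_incr x y : 0 < x -> x < y -> y < PI / 2 -> k0 x < k0 y.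
Proof.
intros Hx Hxy Hy.
destruct (sin_cos_lt1 x) as [s1 c1]; [lra|]; destruct (sin_cos_lt1 y) as [s2 c2]; [lra|].
assert (hc : cos y < cos x) by (apply cos_decreasing_1; lra).
assert (hs : sin x < sin y) by (apply sin_increasing_1; lra).
unfold k0; apply Rmult_lt_compat_l; [apply Rinv_0_lt_compat; assumption|].
assert (/ cos x < / cos y) by (apply Rinv_lt_contravar; nra).
assert (/ sin y < / sin x) by (apply Rinv_lt_contravar; nra).
generalize betab_ge1; nra.
Qed.

(** A dip below both end values would, by the mean value theorem, make [k0 = - G'] positive
    somewhere before [x] and negative somewhere after it, against its monotonicity. *)
Lemma G_quasiconcave u x v : 0 < u -> u <= x <= v -> v < PI / 2 -> Rmin (G u) (G v) <= G x.
Proof.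
intros Hu Hx Hv; apply Rnot_lt_le; intros h.
assert (h1 : G x < G u) by (eapply Rlt_le_trans; [exact h|apply Rmin_l]).
assert (h2 : G x < G v) by (eapply Rlt_le_trans; [exact h|apply Rmin_r]).
assert (u <> x) by (intros ->; lra); assert (x <> v) by (intros ->; lra).
destruct (MVT_cor2 G (fun t => - k0 t) u x) as [r [e1 Hr]]; [lra| |].
{ intros t Ht; apply is_derive_Reals, G_derive; lra. }
destruct (MVT_cor2 G (fun t => - k0 t) x v) as [s [e2 Hs]]; [lra| |].
{ intros t Ht; apply is_derive_Reals, G_derive; lra. }
assert (0 < k0 r) by nra.
assert (k0 s < 0) by nra.
generalize (k0_incr r s); lra.
Qed.

Lemma axis_in_Omega x : 0 < x < PI / 2 -> x <> tb -> in_Omega beta x 0.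
Proof. intros Hx Hn; split; [assumption|intros [e _]; apply Hn, e]. Qed.

Lemma F2_axis x : 0 < x < PI / 2 -> x <> tb ->
  F2 alpha d beta x 0 = k0 x - A * p x * dp x / Rabs (p x) ^ 3.
Proof.
intros Hx Hn; rewrite F2_eq; [rewrite rho_axis; reflexivity|assumption|].
apply rho_pos, axis_in_Omega; assumption.
Qed.

Lemma F2_axis_left x : 0 < x < tb -> F2 alpha d beta x 0 = k0 x + A * (dp x * / p x ^ 2).
Proof.
intros Hx; generalize tb_bounds (p_neg x ltac:(lra)); intros ht hp.
rewrite F2_axis, Rabs_left by lra; field; lra.
Qed.

Lemma F2_axis_right x : tb < x < PI / 2 -> F2 alpha d beta x 0 = k0 x - A * (dp x * / p x ^ 2).
Proof.
intros Hx; generalize tb_bounds (p_pos x ltac:(lra)); intros ht hp.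
rewrite F2_axis, Rabs_right by lra; field; lra.
Qed.

Lemma dp_derive x : is_derive dp x (- p x).
Proof. unfold p, dp; auto_derive; trivial; ring. Qed.

(** Left of [tb] the function [p] is negative and increases towards 0, so [/ p ^ 2] increases; [dp]
    increases as well since its derivative is [- p]. Together with [k0] all ingredients grow. *)
Lemma F2_axis_left_incr x y : 0 < x -> x < y -> y < tb ->
  F2 alpha d beta x 0 < F2 alpha d beta y 0.
Proof.
intros Hx Hxy Hy; generalize tb_bounds A_pos; intros ht hA.
rewrite !F2_axis_left by lra.
assert (hk : k0 x < k0 y) by (apply k0_incr; lra).
assert (hp : p x < p y) by (apply p_incr; lra).
assert (hn : p y < 0) by (apply p_neg; lra).
assert (h0 : 0 < dp x) by (apply dp_pos; lra).
assert (hd : dp x <= dp y).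
{ apply (derive_nonneg_le dp (fun t => - p t)); [lra| |].
  - intros t _; apply dp_derive.
  - intros t Ht; generalize (p_neg t); lra. }
assert (hi : / p x ^ 2 <= / p y ^ 2) by (apply Rinv_le_contravar; nra).
assert (0 < / p x ^ 2) by (apply Rinv_0_lt_compat; nra).
assert (dp x * / p x ^ 2 <= dp y * / p y ^ 2) by (apply Rmult_le_compat; lra).
nra.
Qed.

(** Right of [tb] the sign of [p] is reversed: [dp] and [/ p ^ 2] both decrease, and their product
    enters with a minus sign. *)
Lemma F2_axis_right_incr x y : tb < x -> x < y -> y < PI / 2 ->
  F2 alpha d beta x 0 < F2 alpha d beta y 0.
Proof.
intros Hx Hxy Hy; generalize tb_bounds A_pos; intros ht hA.
rewrite !F2_axis_right by lra.
assert (hk : k0 x < k0 y) by (apply k0_incr; lra).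
assert (hp : p x < p y) by (apply p_incr; lra).
assert (hn : 0 < p x) by (apply p_pos; lra).
assert (h0 : 0 < dp y) by (apply dp_pos; lra).
assert (hd : - dp x <= - dp y).
{ apply (derive_nonneg_le (fun t => - dp t) p); [lra| |].
  - intros t _; evar_last; [refine (is_derive_opp _ _ _ _); apply dp_derive|apply Ropp_involutive].
  - intros t Ht; generalize (p_pos t); lra. }
assert (hi : / p y ^ 2 <= / p x ^ 2) by (apply Rinv_le_contravar; nra).
assert (0 < / p y ^ 2) by (apply Rinv_0_lt_compat; nra).
assert (dp y * / p y ^ 2 <= dp x * / p x ^ 2) by (apply Rmult_le_compat; lra).
nra.
Qed.

Lemma equilibria_exist : exists ts tss, 0 < ts < tb /\ tb < tss < PI / 2 /\
  F2 alpha d beta ts 0 = 0 /\ F2 alpha d beta tss 0 = 0.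
Proof.
generalize tb_bounds A_pos betab_ge1 b_ge1; intros ht hA hbb hb1.
(* This is [F2] on the axis multiplied by [sin x * cos x * p x ^ 2], with [s = 1] on the left of
   [tb] and [s = -1] on the right. Clearing the denominators gives a continuous function up to [0],
   [tb] and [PI / 2], where its sign can be read off. *)
pose (N := fun s x => (beta * b * sin x - cos x) / d * p x ^ 2 + s * A * dp x * sin x * cos x).
assert (cN : forall s, continuity (N s)).
{ intros s x; apply continuity_pt_filterlim, (ex_derive_continuous (N s)).
  unfold N, p, dp; auto_derive; trivial. }
destruct (sin_cos_lt1 tb ht) as [hs hc].
assert (hdp : 0 < A * dp tb * sin tb * cos tb).
{ assert (hdp0 : 0 < dp tb) by (apply dp_pos; lra).
  do 2 (apply Rmult_lt_0_compat; [|lra]); apply Rmult_lt_0_compat; lra. }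
assert (hdb : 0 < d / b) by (apply Rdiv_lt_0_compat; lra).
assert (hid : 0 < / d) by (apply Rinv_0_lt_compat; lra).
destruct (IVT_gen (N 1) 0 tb 0 (cN 1)) as [ts [Hts Ets]].
{ assert (0 < / d * (d / b) ^ 2) by (apply Rmult_lt_0_compat; [assumption|apply pow_lt; assumption]).
  assert (e1 : N 1 0 < 0) by (unfold N, p; rewrite sin_0, cos_0; unfold Rdiv in *; nra).
  assert (e2 : 0 < N 1 tb) by (unfold N; rewrite p_tb; lra).
  rewrite Rmin_left, Rmax_right; lra. }
destruct (IVT_gen (N (-1)) tb (PI / 2) 0 (cN (-1))) as [tss [Htss Etss]].
{ assert (hq : p (PI / 2) = d) by (unfold p; rewrite sin_PI2, cos_PI2; field; lra).
  assert (0 < (beta * b * 1 - 0) / d * d ^ 2).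
  { apply Rmult_lt_0_compat; [apply Rdiv_lt_0_compat; lra|apply pow_lt; assumption]. }
  assert (e1 : N (-1) tb < 0) by (unfold N; rewrite p_tb; lra).
  assert (e2 : 0 < N (-1) (PI / 2)) by (unfold N; rewrite hq, sin_PI2, cos_PI2; lra).
  rewrite Rmin_left, Rmax_right; lra. }
rewrite Rmin_left, Rmax_right in Hts, Htss by lra.
(* The intermediate value theorem yields zeros in closed intervals; the values of [N] at the
   endpoints are nonzero, so the zeros are interior and the denominators may be restored. *)
assert (n0 : ts <> 0).
{ intros ->; revert Ets; unfold N, p; rewrite sin_0, cos_0.
  assert (0 < / d * (d / b) ^ 2) by (apply Rmult_lt_0_compat; [assumption|apply pow_lt; assumption]).
  unfold Rdiv in *; nra. }
assert (n1 : ts <> tb) by (intros ->; revert Ets; unfold N; rewrite p_tb; lra).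
assert (n2 : tss <> tb) by (intros ->; revert Etss; unfold N; rewrite p_tb; lra).
assert (n3 : tss <> PI / 2).
{ intros ->; revert Etss; unfold N, p; rewrite sin_PI2, cos_PI2.
  assert (0 < (beta * b * 1 - 0) / d * (d / b * (b * 1 - 0)) ^ 2).
  { apply Rmult_lt_0_compat; [apply Rdiv_lt_0_compat; lra|apply pow_lt].
    apply Rmult_lt_0_compat; lra. }
  lra. }
exists ts, tss; split; [lra|split; [lra|split]].
- rewrite F2_axis_left by lra.
  destruct (sin_cos_lt1 ts) as [s1 c1]; [lra|]; generalize (p_neg ts ltac:(lra)); intros hp.
  replace (k0 ts + A * (dp ts * / p ts ^ 2)) with (N 1 ts / (sin ts * cos ts * p ts ^ 2))
    by (unfold N, k0; field; lra).
  rewrite Ets; unfold Rdiv; ring.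
- rewrite F2_axis_right by lra.
  destruct (sin_cos_lt1 tss) as [s1 c1]; [lra|]; generalize (p_pos tss ltac:(lra)); intros hp.
  replace (k0 tss - A * (dp tss * / p tss ^ 2)) with (N (-1) tss / (sin tss * cos tss * p tss ^ 2))
    by (unfold N, k0; field; lra).
  rewrite Etss; unfold Rdiv; ring.
Qed.

Lemma energy_axis_derive x : 0 < x < PI / 2 -> x <> tb ->
  is_derive (fun x => energy x 0) x (- F2 alpha d beta x 0).
Proof.
intros Hx Hn.
assert (hr : 0 < rho x 0) by (apply rho_pos, axis_in_Omega; assumption).
evar_last.
- apply (energy_derive (fun x => x) (fun _ => 0)); try assumption.
  + apply @is_derive_id.
  + apply @is_derive_const.
- rewrite F2_eq by assumption; unfold one, zero; simpl; field; lra.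
Qed.

(** For fixed theta, [rho] is smallest on the axis. The vertical line through an equilibrium is
    therefore a barrier for every orbit of lower energy. *)
Lemma energy_ge_axis x y : 0 < x < PI / 2 -> x <> tb -> energy x 0 <= energy x y.
Proof.
intros Hx Hn.
assert (hr : 0 < rho x 0) by (apply rho_pos, axis_in_Omega; assumption).
generalize (rho_ge_axis x y) A_pos; rewrite <- rho_axis; intros h hA.
unfold energy, Rdiv; assert (/ rho x y <= / rho x 0) by (apply Rinv_le_contravar; lra).
nra.
Qed.

Context (ts tss : R) (Hts : 0 < ts < tb) (Htss : tb < tss < PI / 2)
  (Ets : F2 alpha d beta ts 0 = 0) (Etss : F2 alpha d beta tss 0 = 0).

Lemma F2_axis_zero x : 0 < x < PI / 2 -> x <> tb -> F2 alpha d beta x 0 = 0 -> x = ts \/ x = tss.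
Proof.
intros Hx Hn H.
destruct (Rtotal_order x tb) as [h|[h|h]]; [left|contradiction|right].
- destruct (Rtotal_order x ts) as [g|[g|g]]; [|assumption|].
  + generalize (F2_axis_left_incr x ts); lra.
  + generalize (F2_axis_left_incr ts x); lra.
- destruct (Rtotal_order x tss) as [g|[g|g]]; [|assumption|].
  + generalize (F2_axis_right_incr x tss); lra.
  + generalize (F2_axis_right_incr tss x); lra.
Qed.

Lemma equilibrium_iff x y :
  is_equilibrium alpha d beta x y <-> (x = ts /\ y = 0) \/ (x = tss /\ y = 0).
Proof.
generalize tb_bounds A_pos; intros ht hA; split.
- intros [Hin [H1 H2]]; generalize (rho_pos _ _ Hin); intros hr.
  rewrite F1_eq in H1.
  assert (hy : y = 0).
  { destruct (Req_dec y 0) as [e|e]; [assumption|exfalso].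
    apply Rmult_integral in H1; destruct H1 as [H1|H1].
    - apply Rmult_integral in H1; lra.
    - apply (Rinv_neq_0_compat (rho x y ^ 3)); [|assumption]; apply pow_nonzero; lra. }
  subst y; destruct Hin as [Hx Hn].
  destruct (F2_axis_zero x Hx) as [->| ->]; auto.
- assert (F1z : forall x, F1 alpha d beta x 0 = 0) by (intros; rewrite F1_eq; unfold Rdiv; ring).
  intros [[-> ->]|[-> ->]]; (split; [apply axis_in_Omega; lra|split; [apply F1z|assumption]]).
Qed.

Lemma energy_axis_left_incr x y : 0 < x -> x < y -> y <= ts -> energy x 0 < energy y 0.
Proof.
intros; generalize tb_bounds; intros ht.
apply (derive_pos_lt (fun x => energy x 0) (fun t => - F2 alpha d beta t 0)); [assumption| |].
- intros t Ht; apply energy_axis_derive; lra.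
- intros t Ht; generalize (F2_axis_left_incr t ts); lra.
Qed.

Lemma energy_axis_left_decr x y : ts <= x -> x < y -> y < tb -> energy y 0 < energy x 0.
Proof.
intros; generalize tb_bounds; intros ht; apply Ropp_lt_cancel.
apply (derive_pos_lt (fun x => - energy x 0) (fun t => F2 alpha d beta t 0)); [assumption| |].
- intros t Ht; evar_last; [refine (is_derive_opp _ _ _ _); apply energy_axis_derive; lra|].
  apply Ropp_involutive.
- intros t Ht; generalize (F2_axis_left_incr ts t); lra.
Qed.

Lemma energy_axis_right_incr x y : tb < x -> x < y -> y <= tss -> energy x 0 < energy y 0.
Proof.
intros; generalize tb_bounds; intros ht.
apply (derive_pos_lt (fun x => energy x 0) (fun t => - F2 alpha d beta t 0)); [assumption| |].
- intros t Ht; apply energy_axis_derive; lra.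
- intros t Ht; generalize (F2_axis_right_incr t tss); lra.
Qed.

Lemma energy_axis_right_decr x y : tss <= x -> x < y -> y < PI / 2 -> energy y 0 < energy x 0.
Proof.
intros; generalize tb_bounds; intros ht; apply Ropp_lt_cancel.
apply (derive_pos_lt (fun x => - energy x 0) (fun t => F2 alpha d beta t 0)); [assumption| |].
- intros t Ht; evar_last; [refine (is_derive_opp _ _ _ _); apply energy_axis_derive; lra|].
  apply Ropp_involutive.
- intros t Ht; generalize (F2_axis_right_incr tss t); lra.
Qed.

(** * Symmetries, and orbits that enclose the singular point *)

Lemma solution_continuity x y : is_solution alpha d beta x y -> continuity x /\ continuity y.
Proof.
intros Hs; split; intros t; apply derivable_continuous_pt; eexists; apply (Hs t).
Qed.

Lemma solution_shift x y r : is_solution alpha d beta x y ->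
  is_solution alpha d beta (fun t => x (r + t)) (fun t => y (r + t)).
Proof.
intros Hs t; destruct (Hs (r + t)) as [H0 [H1 H2]]; apply is_derive_Reals in H1, H2.
assert (hr : is_derive (fun t : R => r + t) t 1) by (auto_derive; [trivial|ring]).
split; [assumption|split; apply is_derive_Reals].
- evar_last; [apply (is_derive_comp x _ t _ _ H1 hr)|apply Rmult_1_l].
- evar_last; [apply (is_derive_comp y _ t _ _ H2 hr)|apply Rmult_1_l].
Qed.

(** [F1] is odd and [F2] is even in [W], so reflection in the axis combined with time reversal
    preserves the system. *)
Lemma solution_reflect x y : is_solution alpha d beta x y ->
  is_solution alpha d beta (fun t => x (- t)) (fun t => - y (- t)).
Proof.
intros Hs t; destruct (Hs (- t)) as [[Hx Hn] [H1 H2]]; apply is_derive_Reals in H1, H2.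
assert (hr : is_derive (fun t : R => - t) t (-1)) by (auto_derive; [trivial|ring]).
assert (e1 : F1 alpha d beta (x (- t)) (- y (- t)) = -1 * F1 alpha d beta (x (- t)) (y (- t))).
{ rewrite !F1_eq; unfold rho.
  replace ((- y (- t)) ^ 2) with (y (- t) ^ 2) by ring; unfold Rdiv; ring. }
assert (e2 : F2 alpha d beta (x (- t)) (- y (- t)) = F2 alpha d beta (x (- t)) (y (- t))).
{ unfold F2, Dbeta; replace ((- y (- t)) ^ 2) with (y (- t) ^ 2) by ring; reflexivity. }
split; [split; [assumption|intros [h1 h2]; apply Hn; split; [assumption|lra]]|].
rewrite e1, e2; split; apply is_derive_Reals.
- evar_last; [apply (is_derive_comp x _ t _ _ H1 hr)|reflexivity].
- evar_last; [refine (is_derive_opp _ _ _ _); apply (is_derive_comp y _ t _ _ H2 hr)|].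
  unfold scal, opp; simpl; unfold mult; simpl; ring.
Qed.

Lemma solution_equilibrium_const x y t1 q : is_solution alpha d beta x y ->
  is_equilibrium alpha d beta q 0 -> x t1 = q -> y t1 = 0 -> forall t, x t = q /\ y t = 0.
Proof.
intros Hs [Hin [e1 e2]] Hx Hy t.
assert (Hc : is_solution alpha d beta (fun _ => q) (fun _ => 0)).
{ intros r; split; [assumption|]; rewrite e1, e2; split; apply derivable_pt_lim_const. }
generalize (solution_unique _ _ _ _ (solution_shift x y t1 Hs) Hc).
rewrite Rplus_0_r; intros U; generalize (U Hx Hy (t - t1)); simpl.
replace (t1 + (t - t1)) with t by ring; auto.
Qed.

Lemma continuity_stays_above (x : R -> R) k t1 t2 :
  continuity x -> (forall t, x t <> k) -> k < x t1 -> k < x t2.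
Proof.
intros Hc Hn H1; apply Rnot_le_lt; intros H2.
destruct (IVT_gen x t1 t2 k Hc) as [t [_ e]]; [|apply (Hn t e)].
unfold Rmin, Rmax; repeat destruct Rle_dec; lra.
Qed.

Lemma continuity_stays_below (x : R -> R) k t1 t2 :
  continuity x -> (forall t, x t <> k) -> x t1 < k -> x t2 < k.
Proof.
intros Hc Hn H1; apply Rnot_le_lt; intros H2.
destruct (IVT_gen x t1 t2 k Hc) as [t [_ e]]; [|apply (Hn t e)].
unfold Rmin, Rmax; repeat destruct Rle_dec; lra.
Qed.

(** If the ray in direction [s] missed the orbit, a long segment of it would join the point to
    arbitrarily distant ones within the complement, against boundedness of the component. *)
Lemma horizontal_ray_hits x y px : in_bounded_comp x y px 0 -> forall s, s = 1 \/ s = -1 ->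
  exists t r, 0 <= r /\ x t = px + s * r /\ y t = 0.
Proof.
intros [_ [M HM]] s Hs.
apply NNPP; intros Hno.
(* With this length the far end of the segment has abscissa larger than [M] in absolute value in
   either direction. *)
pose (r := Rabs M + Rabs px + 1).
assert (Hreach : Rabs (px + s * r) <= M /\ Rabs 0 <= M).
{ apply HM; exists (fun u => px + s * r * u), (fun _ => 0).
  assert (cc : continuity (fun u => px + s * r * u)) by (intros u; reg).
  repeat split; try ring; auto.
  - intros u; apply continuity_pt_const; intros ? ?; reflexivity.
  - intros u Hu [t [e1 e2]]; apply Hno; exists t, (r * u); repeat split; [|lra|assumption].
    apply Rmult_le_pos; [|lra]; unfold r; generalize (Rabs_pos M) (Rabs_pos px); lra. }
destruct Hreach as [h _]; revert h; unfold r; generalize (Rle_abs M).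
destruct Hs as [->| ->]; unfold Rabs; repeat destruct Rcase_abs; lra.
Qed.

Lemma leapfrogging_only_if x y : is_solution alpha d beta x y -> leapfrogging beta x y ->
  ts < x 0 < tss /\ energy (x 0) (y 0) < Rmin (energy ts 0) (energy tss 0).
Proof.
intros Hs [Hnc [_ Hb']]; generalize tb_bounds; intros ht.
(* A nonconstant solution cannot pass through an equilibrium, by uniqueness; this makes the energy
   inequalities below strict. *)
assert (Hnc' : forall t q, x t = q -> y t = 0 -> q = ts \/ q = tss -> False).
{ intros t q e1 e2 Hq.
  assert (Heq : is_equilibrium alpha d beta q 0)
    by (apply equilibrium_iff; destruct Hq; [left|right]; auto).
  destruct Hnc as [t1 [t2 Hnc]].
  destruct (solution_equilibrium_const x y t q Hs Heq e1 e2 t1) as [a1 a2].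
  destruct (solution_equilibrium_const x y t q Hs Heq e1 e2 t2) as [b1 b2].
  lra. }
destruct (horizontal_ray_hits x y _ Hb' (-1)) as [t1 [r1 [Hr1 [X1 Y1]]]]; [auto|].
destruct (horizontal_ray_hits x y _ Hb' 1) as [t2 [r2 [Hr2 [X2 Y2]]]]; [auto|].
fold tb in X1, X2.
destruct (Hs t1) as [[O1 N1] _]; destruct (Hs t2) as [[O2 N2] _].
assert (L1 : x t1 < tb).
{ destruct (Req_dec (x t1) tb) as [e|e]; [exfalso; apply N1; auto|lra]. }
assert (L2 : tb < x t2).
{ destruct (Req_dec (x t2) tb) as [e|e]; [exfalso; apply N2; auto|lra]. }
clear N1 N2 X1 X2 Hr1 Hr2.
generalize (energy_solution x y Hs t1) (energy_solution x y Hs t2); rewrite Y1, Y2; intros E1 E2.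
assert (C1 : energy (x 0) (y 0) < energy ts 0).
{ rewrite <- E1; destruct (Rtotal_order (x t1) ts) as [h|[h|h]].
  - apply energy_axis_left_incr; lra.
  - exfalso; apply (Hnc' t1 ts); auto.
  - apply energy_axis_left_decr; lra. }
assert (C2 : energy (x 0) (y 0) < energy tss 0).
{ rewrite <- E2; destruct (Rtotal_order (x t2) tss) as [h|[h|h]].
  - apply energy_axis_right_incr; lra.
  - exfalso; apply (Hnc' t2 tss); auto.
  - apply energy_axis_right_decr; lra. }
destruct (solution_continuity x y Hs) as [cx _].
split; [split|apply Rmin_glb_lt; assumption].
(* On the vertical lines through the equilibria the energy is at least the equilibrium energy, hence
   larger than that of the orbit. The orbit thus stays on the side where its axis crossing near [tb]
   lies: [t2] serves for the left line and [t1] for the right one. *)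
- apply (continuity_stays_above x ts t2); [assumption| |lra].
  intros t e; generalize (energy_ge_axis ts (y t)) (energy_solution x y Hs t); rewrite e; lra.
- apply (continuity_stays_below x tss t1); [assumption| |lra].
  intros t e; generalize (energy_ge_axis tss (y t)) (energy_solution x y Hs t); rewrite e; lra.
Qed.

(** * Orbits of energy below both equilibria *)

Section Orbit.
Context (x y : R -> R) (Hsol : is_solution alpha d beta x y) (Hx0 : ts < x 0 < tss)
  (Hlow : energy (x 0) (y 0) < Rmin (energy ts 0) (energy tss 0)).

Let c := energy (x 0) (y 0).

(* On the level set [energy = c] one has [1 / rho = q x], so that [x' = A y q(x)^3], [y' = k x] and
   [y^2 = psi x]: the system reduces to functions of [x] alone. *)
Let q X := (G X - c) / A.
Let k X := k0 X - A * p X * dp X * q X ^ 3.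
Let psi X := / q X ^ 2 - p X ^ 2.

Lemma level_lt_saddles : c < energy ts 0 /\ c < energy tss 0.
Proof.
split; (eapply Rlt_le_trans; [exact Hlow|]); [apply Rmin_l|apply Rmin_r].
Qed.

Lemma orbit_strip t : ts < x t < tss.
Proof.
generalize tb_bounds level_lt_saddles; intros ht [h1 h2].
destruct (solution_continuity x y Hsol) as [cx _].
split.
- apply (continuity_stays_above x ts 0); [assumption| |lra].
  intros s e; generalize (energy_ge_axis ts (y s)) (energy_solution x y Hsol s); rewrite e; fold c; lra.
- apply (continuity_stays_below x tss 0); [assumption| |lra].
  intros s e; generalize (energy_ge_axis tss (y s)) (energy_solution x y Hsol s); rewrite e; fold c; lra.
Qed.

(** At the two ends [G] exceeds the axis energy, which exceeds [c]; quasiconcavity of [G] carries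
    this to the whole closed strip, including [tb]. It makes [/ q] bounded and [psi] continuous
    there. *)
Lemma q_lower_bound : exists e, 0 < e /\ forall X, ts <= X <= tss -> e <= q X.
Proof.
generalize tb_bounds level_lt_saddles A_pos; intros ht [h1 h2] hA.
assert (hG : forall X, 0 < X < PI / 2 -> X <> tb -> energy X 0 < G X).
{ intros X HX Hn; unfold energy.
  assert (0 < A / rho X 0); [|lra].
  apply Rdiv_lt_0_compat; [assumption|apply rho_pos, axis_in_Omega; assumption]. }
exists ((Rmin (G ts) (G tss) - c) / A); split.
- apply Rdiv_lt_0_compat; [|assumption].
  assert (c < Rmin (G ts) (G tss)); [|lra].
  apply Rmin_glb_lt; [generalize (hG ts)|generalize (hG tss)]; lra.
- intros X HX; unfold q, Rdiv; apply Rmult_le_compat_r; [left; apply Rinv_0_lt_compat, hA|].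
  generalize (G_quasiconcave ts X tss); lra.
Qed.

Lemma q_pos X : ts <= X <= tss -> 0 < q X.
Proof. destruct q_lower_bound as [e [He H]]; intros HX; generalize (H X HX); lra. Qed.

Lemma energy_level_iff X Y : ts <= X <= tss -> 0 < rho X Y -> (energy X Y = c <-> / rho X Y = q X).
Proof.
intros HX Hr; generalize A_pos; intros hA; unfold energy, q; split; intros H.
- replace (G X - c) with (A / rho X Y) by lra; field; lra.
- unfold Rdiv at 1; rewrite H; field; lra.
Qed.

Lemma orbit_inv_rho t : / rho (x t) (y t) = q (x t).
Proof.
destruct (Hsol t) as [Hin _]; generalize (orbit_strip t); intros Hs.
apply energy_level_iff; [lra|apply rho_pos, Hin|apply energy_solution, Hsol].
Qed.

Lemma orbit_y_sqr t : y t ^ 2 = psi (x t).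
Proof.
destruct (Hsol t) as [Hin _]; generalize (rho_pos _ _ Hin) (rho_sqr (x t) (y t)); intros hr e.
unfold psi; rewrite <- orbit_inv_rho.
replace (/ (/ rho (x t) (y t)) ^ 2) with (rho (x t) (y t) ^ 2) by (field; lra); lra.
Qed.

Lemma orbit_derive t :
  is_derive x t (A * y t * q (x t) ^ 3) /\ is_derive y t (k (x t)).
Proof.
destruct (Hsol t) as [Hin [H1 H2]]; generalize (rho_pos _ _ Hin); intros hr.
unfold k; rewrite <- orbit_inv_rho.
rewrite F1_eq in H1; rewrite F2_eq in H2; [|apply Hin|assumption].
apply is_derive_Reals in H1, H2; split.
- evar_last; [exact H1|field; lra].
- evar_last; [exact H2|field; lra].
Qed.

Lemma orbit_y_bounded : exists B, 0 < B /\ (forall t, Rabs (y t) <= B) /\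
  forall X, ts <= X <= tss -> / q X <= B.
Proof.
destruct q_lower_bound as [e [He H]].
assert (hq : forall X, ts <= X <= tss -> / q X <= / e)
  by (intros X HX; apply Rinv_le_contravar; [assumption|apply H, HX]).
exists (/ e); split; [apply Rinv_0_lt_compat; assumption|split; [|assumption]].
intros t; generalize (orbit_strip t); intros Hs.
destruct (Hsol t) as [Hin _]; generalize (rho_pos _ _ Hin); intros hr.
apply Rle_trans with (rho (x t) (y t)); [apply rho_ge_abs|].
rewrite <- (Rinv_inv (rho (x t) (y t))), orbit_inv_rho; apply hq; lra.
Qed.

Lemma q_derivable X : 0 < X < PI / 2 -> ex_derive q X.
Proof.
intros HX; assert (ex_derive G X) by (eexists; apply G_derive, HX).
unfold q; auto_derive; assumption.
Qed.

Lemma psi_continuous X : ts <= X <= tss -> continuity_pt psi X.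
Proof.
intros HX; generalize tb_bounds (q_pos X HX); intros ht hq.
apply continuity_pt_filterlim, (ex_derive_continuous psi).
assert (ex_derive q X) by (apply q_derivable; lra).
assert (ex_derive p X) by (eexists; apply p_derive).
unfold psi; generalize dependent q; intros; auto_derive; repeat split; auto.
apply Rgt_not_eq; nra.
Qed.

Lemma k_continuous X : ts <= X <= tss -> continuity_pt k X.
Proof.
intros HX; generalize tb_bounds (q_pos X HX); intros ht hq.
apply continuity_pt_filterlim, (ex_derive_continuous k).
assert (ex_derive q X) by (apply q_derivable; lra).
assert (ex_derive p X) by (eexists; apply p_derive).
assert (ex_derive dp X) by (eexists; apply dp_derive).
destruct (sin_cos_lt1 X) as [h1 h2]; [lra|].
unfold k, k0; auto_derive; repeat split; auto; lra.
Qed.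

Lemma psi_zero_iff X : ts <= X <= tss -> (psi X = 0 <-> X <> tb /\ energy X 0 = c).
Proof.
intros HX; generalize tb_bounds A_pos (q_pos X HX); intros ht hA hq.
assert (hiq : 0 < / q X) by (apply Rinv_0_lt_compat; assumption).
unfold psi; rewrite <- pow_inv; split.
- intros H.
  assert (hp : / q X = Rabs (p X)).
  { rewrite <- (Rabs_pos_eq (/ q X)) by lra; apply Rsqr_eq_abs_0; unfold Rsqr; lra. }
  assert (hn : X <> tb) by (intros ->; rewrite p_tb, Rabs_R0 in hp; lra).
  split; [assumption|].
  apply energy_level_iff; [assumption|rewrite rho_axis; lra|].
  rewrite rho_axis, <- hp; apply Rinv_inv.
- intros [hn H].
  assert (hr : 0 < rho X 0) by (apply rho_pos, axis_in_Omega; lra).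
  apply energy_level_iff in H; [|assumption|assumption].
  rewrite <- H, Rinv_inv, rho_sqr; ring.
Qed.

(** An axis energy above [c] means [/ |p| < q], that is [p ^ 2 > / q ^ 2]: the level curve has no
    point on these vertical lines. *)
Lemma psi_at_saddles : psi ts < 0 /\ psi tss < 0.
Proof.
generalize tb_bounds level_lt_saddles A_pos; intros ht [h1 h2] hA.
assert (main : forall X, ts <= X <= tss -> X <> tb -> c < energy X 0 -> psi X < 0).
{ intros X HX hn hE; generalize (q_pos X HX); intros hq.
  assert (hr : 0 < rho X 0) by (apply rho_pos, axis_in_Omega; lra).
  assert (h : / rho X 0 < q X).
  { unfold energy, Rdiv in hE; unfold q, Rdiv; apply Rmult_lt_reg_l with A; [assumption|].
    replace (A * ((G X - c) * / A)) with (G X - c) by (field; lra); lra. }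
  apply Rinv_lt_contravar in h.
  2: { apply Rmult_lt_0_compat; [apply Rinv_0_lt_compat|]; assumption. }
  rewrite Rinv_inv in h; unfold psi; rewrite <- pow_inv.
  assert (0 < / q X) by (apply Rinv_0_lt_compat; assumption).
  generalize (rho_sqr X 0); nra. }
split; apply main; lra.
Qed.

(** A zero of [psi] is an axis point of energy [c], where [k] agrees with [F2]; if [F2] vanished
    too, the point would be an equilibrium, and both have energy above [c]. *)
Lemma no_rest_point X : ts <= X <= tss -> psi X = 0 -> k X <> 0.
Proof.
intros HX Hpsi Hk; generalize tb_bounds level_lt_saddles; intros ht [h1 h2].
apply psi_zero_iff in Hpsi; [|assumption]; destruct Hpsi as [hn hE].
assert (hr : 0 < rho X 0) by (apply rho_pos, axis_in_Omega; lra).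
destruct (F2_axis_zero X) as [e|e]; try lra.
- rewrite F2_eq by lra; apply energy_level_iff in hE; [|assumption|assumption].
  unfold k in Hk; rewrite <- hE in Hk; eapply eq_trans; [|exact Hk]; field; lra.
- rewrite e in hE; lra.
- rewrite e in hE; lra.
Qed.

(** If [y] kept a sign [s] after [t0], then [s * x] would be monotone and bounded, so [x] would have
    a limit [l]. Both velocities are continuous functions of [x] and so converge; since [x] and [y]
    are bounded, their limits vanish, giving [psi l = 0] and [k l = 0], which [no_rest_point]
    excludes. *)
Lemma orbit_returns t0 : exists t, t0 <= t /\ y t = 0.
Proof.
apply NNPP; intros Hno.
generalize A_pos; intros hA.
assert (Hn : forall t, t0 <= t -> y t <> 0) by (intros t Ht e; apply Hno; exists t; auto).
destruct (solution_continuity x y Hsol) as [cx cy].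
assert (Hsign : exists s, (s = 1 \/ s = -1) /\ forall t, t0 <= t -> s * y t = Rabs (y t)).
{ destruct (Rlt_dec 0 (y t0)) as [h|h]; [exists 1|exists (-1)]; (split; [auto|]);
    intros t Ht; unfold Rabs; destruct Rcase_abs; try lra; exfalso;
    destruct (IVT_gen y t0 t 0 cy) as [v [Hv e]];
    try (unfold Rmin, Rmax; repeat destruct Rle_dec; lra);
    rewrite Rmin_left in Hv by assumption; apply (Hn v); lra. }
destruct Hsign as [s [Hs Hsy]].
assert (dsx : forall t, is_derive (fun t => s * x t) t (s * (A * y t * q (x t) ^ 3))).
{ intros t; apply is_derive_scal, orbit_derive. }
(* Once the sign of [y] is fixed, [|y|] is the square root of [psi (x t)], and the velocity depends
   on [x] alone. *)
assert (dsx_eq : forall t, t0 <= t ->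
  s * (A * y t * q (x t) ^ 3) = A * sqrt (psi (x t)) * q (x t) ^ 3).
{ intros t Ht; rewrite <- orbit_y_sqr, <- Rsqr_pow2, sqrt_Rsqr_abs, <- Hsy by assumption; ring. }
assert (sx_bd : forall t, Rabs (s * x t) <= PI / 2).
{ intros t; generalize (orbit_strip t) tb_bounds; intros h1 h2.
  rewrite Rabs_mult, (Rabs_pos_eq (x t)) by lra.
  destruct Hs as [->| ->]; unfold Rabs; destruct Rcase_abs; lra. }
destruct (monotone_tends_to (fun t => s * x t) t0 (PI / 2)) as [l0 Hl0].
{ intros r t Hr Hrt.
  apply (derive_nonneg_le _ _ _ _ Hrt (fun t _ => dsx t)).
  intros u Hu; rewrite dsx_eq by lra.
  generalize (orbit_strip u); intros hu.
  apply Rmult_le_pos; [apply Rmult_le_pos; [lra|apply sqrt_pos]|].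
  apply pow_le; left; apply q_pos; lra. }
{ intros t Ht; generalize (Rle_abs (s * x t)) (sx_bd t); lra. }
assert (Hl : exists l, tends_to x l).
{ destruct Hs as [->| ->].
  - exists l0; intros e He; destruct (Hl0 e He) as [T HT]; exists T; intros t Ht.
    generalize (HT t Ht); rewrite Rmult_1_l; auto.
  - exists (- l0); intros e He; destruct (Hl0 e He) as [T HT]; exists T; intros t Ht.
    rewrite <- Rabs_Ropp; replace (- (x t - - l0)) with (-1 * x t - l0) by ring; auto. }
destruct Hl as [l Hl].
assert (Hlr : ts <= l <= tss).
{ split; apply Rnot_lt_le; intros h.
  - destruct (Hl (ts - l)) as [T HT]; [lra|]; generalize (HT T (Rle_refl T)) (orbit_strip T).
    intros g; apply Rabs_def2 in g; lra.
  - destruct (Hl (l - tss)) as [T HT]; [lra|]; generalize (HT T (Rle_refl T)) (orbit_strip T).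
    intros g; apply Rabs_def2 in g; lra. }
assert (Hpsi : tends_to (fun t => psi (x t)) (psi l))
  by (apply tends_to_comp; [|apply psi_continuous]; assumption).
assert (Hpsi0 : 0 <= psi l).
{ apply (tends_to_ge0 _ _ t0 Hpsi); intros t _; rewrite <- orbit_y_sqr; apply pow2_ge_0. }
generalize (q_pos l Hlr); intros hq.
assert (Hk : k l = 0).
{ destruct orbit_y_bounded as [B [_ [HB _]]].
  apply (bounded_derive_limit y (fun t => k (x t)) (k l) t0 B).
  - intros t _; apply orbit_derive.
  - intros t _; apply HB.
  - apply tends_to_comp; [|apply k_continuous]; assumption. }
assert (Hz : A * sqrt (psi l) * q l ^ 3 = 0).
{ apply (bounded_derive_limit (fun t => s * x t)
    (fun t => A * sqrt (psi (x t)) * q (x t) ^ 3) _ t0 (PI / 2)).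
  - intros t Ht; rewrite <- dsx_eq by assumption; apply dsx.
  - intros t _; apply sx_bd.
  - apply (tends_to_comp x l (fun X => A * sqrt (psi X) * q X ^ 3)); [assumption|].
    generalize tb_bounds; intros ht.
    apply continuity_pt_mult.
    + apply continuity_pt_mult; [apply continuity_pt_const; intros ? ?; reflexivity|].
      apply (continuity_pt_comp psi sqrt); [apply psi_continuous; assumption|].
      apply continuity_pt_sqrt; assumption.
    + apply (continuity_pt_comp q (fun u => u ^ 3));
        [|apply derivable_continuous_pt, derivable_pt_pow].
      apply continuity_pt_filterlim, (ex_derive_continuous q), q_derivable; lra. }
apply (no_rest_point l Hlr); [|assumption].
apply Rmult_integral in Hz; destruct Hz as [Hz|Hz].
- apply Rmult_integral in Hz; destruct Hz as [Hz|Hz]; [lra|].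
  apply sqrt_eq_0; assumption.
- exfalso; apply (pow_nonzero (q l) 3); [lra|assumption].
Qed.

(** A point on the axis is its own mirror image, so the orbit restarted at [t1] and its
    time-reversed reflection have the same initial data. *)
Lemma orbit_reflect t1 : y t1 = 0 -> forall r, x (t1 - r) = x (t1 + r) /\ y (t1 - r) = - y (t1 + r).
Proof.
intros H1 r.
assert (S1 := solution_shift x y t1 Hsol).
assert (S2 := solution_reflect _ _ S1).
destruct (solution_unique _ _ _ _ S1 S2) with (t := r) as [e1 e2].
- simpl; rewrite Ropp_0; reflexivity.
- simpl; rewrite Ropp_0, Rplus_0_r, H1; ring.
- simpl in e1, e2; unfold Rminus; rewrite e1, e2; split; ring.
Qed.

Lemma orbit_axis_E t : y t = 0 -> x t <> tb /\ energy (x t) 0 = c.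
Proof.
intros H; destruct (Hsol t) as [[_ Hn] _]; split.
- intros e; apply Hn; auto.
- rewrite <- H; apply energy_solution, Hsol.
Qed.

(** On the axis [k] is [F2], which increases on each side of [tb] and vanishes at [ts] and [tss];
    the orbit lies strictly between these. Crossings thus go upwards on the left and downwards on
    the right. *)
Lemma orbit_crossing_velocity t : y t = 0 ->
  (x t < tb -> 0 < k (x t)) /\ (tb < x t -> k (x t) < 0).
Proof.
intros H; generalize tb_bounds (orbit_strip t); intros ht hs.
assert (e : k (x t) = F2 alpha d beta (x t) 0).
{ destruct (orbit_derive t) as [_ D]; destruct (Hsol t) as [_ [_ D']]; apply is_derive_Reals in D'.
  rewrite H in D'; rewrite <- (is_derive_unique _ _ _ D); apply is_derive_unique, D'. }
rewrite e; split; intros h.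
- generalize (F2_axis_left_incr ts (x t)); lra.
- generalize (F2_axis_right_incr (x t) tss); lra.
Qed.

(** There are two crossing times, separated by at least 1. If all crossings were on one side, they
    would all have the same direction, which [no_two_upcrossings] forbids for [y] or for [- y]. *)
Lemma orbit_crosses_both_sides :
  (exists t, y t = 0 /\ x t < tb) /\ (exists t, y t = 0 /\ tb < x t).
Proof.
destruct (orbit_returns 0) as [t1 [_ H1]].
destruct (orbit_returns (t1 + 1)) as [t2 [H12 H2]].
split; apply NNPP; intros Hno.
- apply (no_two_upcrossings (fun t => - y t) (fun t => - k (x t)) t1 t2); try lra.
  + intros t; refine (is_derive_opp _ _ _ _); apply orbit_derive.
  + intros t Ht; assert (Ht' : y t = 0) by lra.
    destruct (orbit_axis_E t Ht') as [hn _]; destruct (orbit_crossing_velocity t Ht') as [_ hv].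
    assert (~ x t < tb) by (intros h; apply Hno; exists t; auto).
    assert (k (x t) < 0) by (apply hv; lra); lra.
- apply (no_two_upcrossings y (fun t => k (x t)) t1 t2); try lra.
  + intros t; apply orbit_derive.
  + intros t Ht; destruct (orbit_axis_E t Ht) as [hn _].
    destruct (orbit_crossing_velocity t Ht) as [hv _].
    assert (~ tb < x t) by (intros h; apply Hno; exists t; auto); apply hv; lra.
Qed.

(** The abscissas of the level curve lie between the left and right axis crossings of the orbit, so
    [x] takes the value [X]; the orbit is symmetric in the axis, so both signs of the ordinate
    occur. *)
Lemma orbit_is_level_curve X Y : ts <= X <= tss -> Y ^ 2 = psi X -> in_orbit x y X Y.
Proof.
intros HX HY; generalize tb_bounds A_pos (q_pos X HX); intros ht hA hq.
destruct orbit_crosses_both_sides as [[tl [Yl Ll]] [tr [Yr Lr]]].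
destruct (orbit_axis_E tl Yl) as [_ El]; destruct (orbit_axis_E tr Yr) as [_ Er].
destruct (solution_continuity x y Hsol) as [cx _].
assert (Haxis : X <> tb -> energy X 0 <= c).
{ intros hn.
  assert (hr : 0 < rho X 0) by (apply rho_pos, axis_in_Omega; lra).
  assert (h : rho X 0 <= / q X).
  { assert (0 < / q X) by (apply Rinv_0_lt_compat; assumption).
    unfold psi in HY; rewrite <- pow_inv in HY; generalize (rho_sqr X 0) (pow2_ge_0 Y); nra. }
  apply Rinv_le_contravar in h; [|assumption]; rewrite Rinv_inv in h.
  unfold energy, Rdiv; assert (A * q X <= A * / rho X 0) by (apply Rmult_le_compat_l; lra).
  replace (A * q X) with (G X - c) in H by (unfold q; field; lra); lra. }
generalize (orbit_strip tl) (orbit_strip tr); intros sl sr.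
(* From [ts] to [x tl] and from [x tr] to [tss] the axis energy lies above [c] except at the
   crossings themselves, while [Haxis] bounds it by [c] at [X]. *)
assert (B : x tl <= X <= x tr).
{ split; apply Rnot_lt_le; intros h.
  - generalize (energy_axis_left_decr X (x tl)) (Haxis ltac:(lra)); lra.
  - generalize (energy_axis_right_incr (x tr) X) (Haxis ltac:(lra)); lra. }
destruct (IVT_gen x tl tr X cx) as [t [_ Ht]].
{ rewrite Rmin_left, Rmax_right; lra. }
generalize (orbit_y_sqr t); rewrite Ht, <- HY; intros e.
destruct (Req_dec (y t) Y) as [h|h]; [exists t; auto|].
(* Here [y t = - Y], and reflecting the time [t] about the crossing time [tl] changes this sign. *)
exists (tl - (t - tl)); destruct (orbit_reflect tl Yl (t - tl)) as [e1 e2].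
rewrite e1, e2; replace (tl + (t - tl)) with t by ring; split; [assumption|nra].
Qed.

Lemma orbit_encloses : in_bounded_comp x y tb 0.
Proof.
generalize tb_bounds A_pos psi_at_saddles; intros ht hA [P1 P2].
destruct orbit_y_bounded as [B [HB [_ Hq]]].
split.
- intros [t [e1 e2]]; destruct (Hsol t) as [[_ Hn] _]; apply Hn; auto.
(* This one number bounds the abscissa, at most [tss] in the strip, and the ordinate, at most [B] on
   the level curve. *)
- exists (tss + B); intros qx qy [gx [gy [cx [cy [ex0 [ey0 [ex1 [ey1 Hav]]]]]]]].
  apply NNPP; intros Hout.
  (* Clamping the abscissa to the strip keeps [psi] continuous. Outside the strip [psi] is then
     evaluated at [ts] or [tss], where it is negative, so [f > 0]. Along the path [f] goes from
     negative to positive, and its zero is a point of the orbit. *)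
  pose (cl := fun X => Rmax ts (Rmin tss X)).
  assert (Hcl : forall X, ts <= cl X <= tss)
    by (intros X; unfold cl, Rmax, Rmin; repeat destruct Rle_dec; lra).
  pose (f := fun s => gy s ^ 2 - psi (cl (gx s))).
  assert (cf : continuity f).
  { intros s; apply continuity_pt_minus.
    - apply (continuity_pt_comp gy (fun u => u ^ 2));
        [apply cy|apply derivable_continuous_pt, derivable_pt_pow].
    - apply (continuity_pt_comp (fun s => cl (gx s)) psi); [|apply psi_continuous, Hcl].
      apply (continuity_pt_ext (fun t => - Rmin (- ts) (- Rmin tss (gx t)))).
      + intros r; unfold cl; rewrite <- Ropp_Rmax, !Ropp_involutive; reflexivity.
      + apply continuity_pt_opp, continuity_Rmin.
        * intros r; apply continuity_pt_const; intros ? ?; reflexivity.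
        * apply continuity_opp, continuity_Rmin; [|assumption].
          intros r; apply continuity_pt_const; intros ? ?; reflexivity. }
  assert (out : forall s, ~ ts < gx s < tss -> 0 < f s).
  { intros s Hs; unfold f; generalize (pow2_ge_0 (gy s)); intros h.
    destruct (Rle_dec (gx s) ts) as [g|g].
    - replace (cl (gx s)) with ts by (unfold cl, Rmax, Rmin; repeat destruct Rle_dec; lra); lra.
    - replace (cl (gx s)) with tss by (unfold cl, Rmax, Rmin; repeat destruct Rle_dec; lra); lra. }
  assert (f0 : f 0 < 0).
  { unfold f; rewrite ex0, ey0.
    replace (cl tb) with tb by (unfold cl, Rmax, Rmin; repeat destruct Rle_dec; lra).
    unfold psi; rewrite p_tb.
    assert (0 < / q tb ^ 2) by (apply Rinv_0_lt_compat, pow_lt, q_pos; lra); lra. }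
  assert (f1 : 0 < f 1).
  { destruct (classic (ts < gx 1 < tss)) as [h|h]; [|apply out, h].
    assert (hy : B < Rabs (gy 1)).
    { apply Rnot_le_lt; intros g; apply Hout; rewrite <- ex1, <- ey1, Rabs_pos_eq; lra. }
    unfold f; rewrite <- (pow2_abs (gy 1)).
    generalize (Hq _ (Hcl (gx 1))) (q_pos _ (Hcl (gx 1))); intros h1 h2.
    unfold psi; rewrite <- pow_inv.
    assert (0 < / q (cl (gx 1))) by (apply Rinv_0_lt_compat; assumption).
    generalize (pow2_ge_0 (p (cl (gx 1)))); nra. }
  destruct (IVT_gen f 0 1 0 cf) as [s [Hs e]]; [rewrite Rmin_left, Rmax_right; lra|].
  rewrite Rmin_left, Rmax_right in Hs by lra.
  apply (Hav s Hs).
  assert (Hin : ts < gx s < tss).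
  { apply NNPP; intros h; generalize (out s h); lra. }
  apply orbit_is_level_curve; [lra|].
  unfold f in e; replace (cl (gx s)) with (gx s) in e
    by (unfold cl, Rmax, Rmin; repeat destruct Rle_dec; lra); lra.
Qed.

Lemma leapfrogging_if : leapfrogging beta x y.
Proof.
destruct orbit_crosses_both_sides as [[tl [Yl Ll]] [tr [Yr Lr]]].
split; [exists tl, tr; left; lra|split; [|apply orbit_encloses]].
destruct (orbit_returns 0) as [t1 [_ H1]].
destruct (orbit_returns (t1 + 1)) as [t2 [H12 H2]].
(* The reflection about [t1] sends [t] to [2 t1 - t], and the reflection about [t2] sends this to
   [t + 2 (t2 - t1)]; the two sign changes of [y] cancel. The gap of at least 1 makes the period
   positive. *)
exists (2 * (t2 - t1)); split; [lra|intros t].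
destruct (orbit_reflect t1 H1 (t1 - t)) as [e1 e2].
destruct (orbit_reflect t2 H2 (t + t2 - 2 * t1)) as [e3 e4].
replace (t1 - (t1 - t)) with t in * by ring.
replace (t2 + (t + t2 - 2 * t1)) with (t + 2 * (t2 - t1)) in * by ring.
replace (t2 - (t + t2 - 2 * t1)) with (t1 + (t1 - t)) in * by ring.
rewrite <- e3, e1; split; [reflexivity|lra].
Qed.

End Orbit.
End Leapfrog.

Theorem theorem2 (alpha d beta : R) :
  0 < alpha < 1 / 3 -> 0 < d -> 1 <= beta ->
  exists ts tss : R,
    0 < ts < theta_b beta /\ theta_b beta < tss < PI / 2 /\
    (forall th W, is_equilibrium alpha d beta th W <->
                  ((th = ts /\ W = 0) \/ (th = tss /\ W = 0))) /\
    (forall th0 W0, in_Omega beta th0 W0 ->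
      ((forall th w : R -> R, is_solution alpha d beta th w ->
          th 0 = th0 -> w 0 = W0 -> leapfrogging beta th w)
       <->
       (ts < th0 < tss /\
        Ham alpha d beta th0 W0 < Rmin (Ham alpha d beta ts 0) (Ham alpha d beta tss 0)))).
Proof.
intros [Ha _] Hd Hb.
destruct (equilibria_exist alpha d beta Ha Hd Hb) as [ts [tss [Hts [Htss [E1 E2]]]]].
exists ts, tss; split; [assumption|split; [assumption|split]].
- intros; apply equilibrium_iff; assumption.
- intros th0 W0 Hin; generalize (tb_bounds beta Hb); intros ht.
  rewrite !(Ham_eq alpha d beta Hb) by first [apply Hin | lra].
  split.
  (* Condition (i) quantifies over all solutions with these data, so global existence is what gives
     it content. *)
  + intros Hleap; destruct (solution_exists alpha d beta Ha Hd Hb th0 W0 Hin) as [x [y [Hs [e1 e2]]]].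
    rewrite <- e1, <- e2.
    apply (leapfrogging_only_if alpha d beta Ha Hd Hb ts tss); auto.
  + intros [Hx HE] th w Hs e1 e2; subst th0 W0.
    apply (leapfrogging_if alpha d beta Ha Hd Hb ts tss); auto.
Qed.
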